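(* Let $K$ be a field and let $R$ be a finite-dimensional $K$-algebra such that there is an isomorphism of $R$-bimodules $\varphi:(R^* )^{\otimes_R n}\to R$ for some integer $n\geq 2$. Then: (i) $A(R,R^*,\varphi)$ is $\hat{1}$-graded Frobenius, and it is a symmetric algebra. (ii) If moreover $R$ is Frobenius, then $A(R,R^*,\varphi)$ is $\hat{i}$-graded Frobenius for any $0\leq i<n$.
   Context: All algebras, vector spaces and linear duals are over $K$; $R^*=\mathrm{Hom}_K(R,K)$ is an $R$-bimodule via $(r\rightharpoonup r^* )(s)=r^*(sr)$ and $(r^*\leftharpoonup r)(s)=r^*(rs)$. Convention: $M^{\otimes_R 0}=R$, $M^{\otimes_R 1}=M$. For an $R$-bimodule $M$, a bimodule morphism $\varphi:M^{\otimes_R n}\to R$ is associative if $\varphi(m_1\otimes_R\cdots\otimes_R m_n)m_{n+1}=m_1\varphi(m_2\otimes_R\cdots\otimes_R m_{n+1})$ for all $m_1,\ldots,m_{n+1}\in M$. When $(R^* )^{\otimes_R n}\simeq R$ as $R$-bimodules, every bimodule morphism $(R^* )^{\otimes_R n}\to R$ is associative (another result of the paper), so the construction below applies to $\varphi$. For associative $\varphi$, $A(R,M,\varphi)$ is the factor algebra of the tensor algebra $T_R(M)=\bigoplus_{i\geq 0}M^{\otimes_R i}$ by the two-sided ideal generated by all elements $m_1\otimes_R\cdots\otimes_R m_n-\varphi(m_1\otimes_R\cdots\otimes_R m_n)$. It is identified with $R\oplus M\oplus\cdots\oplus M^{\otimes_R(n-1)}$, where the multiplication is tensor concatenation if the total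 length is less than $n$, and otherwise concatenation followed by applying $\varphi$ to $n$ successive tensor positions (the choice is irrelevant by associativity). It is $\mathbb{Z}_n$-graded, with homogeneous component of degree $\hat{i}$ equal to $M^{\otimes_R i}$ for $0\leq i\leq n-1$, where $\hat{i}$ is the class of $i$ modulo $n$. Here $M=R^*$. A finite-dimensional algebra $B$ is Frobenius if $B^*\simeq B$ as left $B$-modules, and symmetric if $B^*\simeq B$ as $B$-bimodules. For a finite-dimensional algebra $A$ graded by a group $G$ and $\sigma\in G$: $A^*$ is graded by $(A^* )_g=\{a^*\in A^* : a^*(A_h)=0\text{ for all }h\neq g^{-1}\}$, $A(\sigma)$ is the left $A$-module $A$ with grading $A(\sigma)_g=A_{g\sigma}$, and $A$ is $\sigma$-graded Frobenius if $A^*\simeq A(\sigma)$ as graded left $A$-modules. Here $G=\mathbb{Z}_n$ (additive). *)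

(* Defs.v *)
From HB Require Import structures.
From mathcomp Require Import all_boot all_algebra.
From mathcomp Require Import boolp.
From mathcomp Require Import finmap monalg.

Set Implicit Arguments.
Unset Strict Implicit.
Unset Printing Implicit Defensive.

Import GRing.Theory.
Local Open Scope ring_scope.
Local Open Scope quotient_scope.

(* Unital associative K-algebras.  Unlike in algType, 1 != 0 is not required:
   the quotient of an algebra by an arbitrary ideal has to be one again. *)
Record pzAlgebra (K : fieldType) := PzAlgebra {
  pzalg_lmod : lmodType K;
  pzalg_mul : pzalg_lmod -> pzalg_lmod -> pzalg_lmod;
  pzalg_one : pzalg_lmod;
  pzalg_mulA : associative pzalg_mul;
  pzalg_mul1r : left_id pzalg_one pzalg_mul;
  pzalg_mulr1 : right_id pzalg_one pzalg_mul;
  pzalg_mulDl : left_distributive pzalg_mul +%R;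
  pzalg_mulDr : right_distributive pzalg_mul +%R;
  pzalg_scalAl : forall (k : K) x y,
    k *: pzalg_mul x y = pzalg_mul (k *: x) y;
  pzalg_scalAr : forall (k : K) x y,
    k *: pzalg_mul x y = pzalg_mul x (k *: y)
}.

Definition pzalg_sort (K : fieldType) (A : pzAlgebra K) : Type := pzalg_lmod A.
Coercion pzalg_sort : pzAlgebra >-> Sortclass.

Section PzAlgebraTheory.
Variables (K : fieldType) (A : pzAlgebra K).

HB.instance Definition _ := GRing.Lmodule.copy (pzalg_sort A) (pzalg_lmod A).
HB.instance Definition _ := GRing.Zmodule_isPzRing.Build (pzalg_sort A)
  (@pzalg_mulA K A) (@pzalg_mul1r K A) (@pzalg_mulr1 K A)
  (@pzalg_mulDl K A) (@pzalg_mulDr K A).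

Lemma pzscalerAl (k : K) (x y : A) : k *: (x * y) = (k *: x) * y.
Proof. exact: pzalg_scalAl. Qed.

Lemma pzscalerAr (k : K) (x y : A) : k *: (x * y) = x * (k *: y).
Proof. exact: pzalg_scalAr. Qed.

End PzAlgebraTheory.

Definition pzalgebra_of_alg (K : fieldType) (A : algType K) : pzAlgebra K :=
  @PzAlgebra K A *%R 1 (@mulrA A) (@mul1r A) (@mulr1 A) (@mulrDl A) (@mulrDr A)
    (@scalerAl K A) (@scalerAr K A).

(* R-bimodules on which K acts in the same way through either side of R. *)
HB.mixin Record Lmodule_isBimodule (K : fieldType) (R : pzAlgebra K) V
    of GRing.Lmodule K V := {
  lact : R -> V -> V;
  ract : V -> R -> V;
  lactDl : forall r s v, lact (r + s) v = lact r v + lact s v;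
  lactDr : forall r v w, lact r (v + w) = lact r v + lact r w;
  lactZl : forall (k : K) r v, lact (k *: r) v = k *: lact r v;
  lact1 : forall v, lact 1 v = v;
  lactA : forall r s v, lact (r * s) v = lact r (lact s v);
  ractDl : forall v w r, ract (v + w) r = ract v r + ract w r;
  ractDr : forall v r s, ract v (r + s) = ract v r + ract v s;
  ractZr : forall (k : K) v r, ract v (k *: r) = k *: ract v r;
  ract1 : forall v, ract v 1 = v;
  ractA : forall v r s, ract v (r * s) = ract (ract v r) s;
  lractA : forall r v s, ract (lact r v) s = lact r (ract v s)
}.

#[short(type="bimodType")]
HB.structure Definition Bimodule (K : fieldType) (R : pzAlgebra K) :=
  {V of GRing.Lmodule K V & Lmodule_isBimodule K R V}.

Section BimoduleTheory.
Variables (K : fieldType) (R : pzAlgebra K) (V : bimodType R).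
Implicit Types (k : K) (r : R) (v : V).

Lemma lactZr k r v : lact r (k *: v) = k *: lact r v.
Proof.
by rewrite -{1}[v](@lact1 K R) -lactZl -lactA -pzscalerAr mulr1 lactZl.
Qed.

Lemma ractZl k v r : ract (k *: v) r = k *: ract v r.
Proof.
by rewrite -{1}[v](@ract1 K R) -ractZr -ractA -pzscalerAl mul1r ractZr.
Qed.

Lemma lact0l v : lact (0 : R) v = 0.
Proof. by have := lactZl 0 (0 : R) v; rewrite !scale0r. Qed.

Lemma lact0r r : lact r (0 : V) = 0.
Proof. by have := lactZr 0 r 0; rewrite !scale0r. Qed.

Lemma ract0l r : ract (0 : V) r = 0.
Proof. by have := ractZl 0 0 r; rewrite !scale0r. Qed.

Lemma ract0r v : ract v (0 : R) = 0.
Proof. by have := ractZr 0 v (0 : R); rewrite !scale0r. Qed.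

End BimoduleTheory.

Section Morphisms.
Variables (K : fieldType) (R : pzAlgebra K) (V W : bimodType R) (f : V -> W).

Definition left_iso : Prop :=
  [/\ linear f, forall (r : R) v, f (lact r v) = lact r (f v) & bijective f].

Definition bimod_iso : Prop :=
  left_iso /\ forall v (r : R), f (ract v r) = ract (f v) r.

End Morphisms.

Definition regbim (K : fieldType) (R : pzAlgebra K) : Type := R.

Section RegularBimodule.
Variables (K : fieldType) (R : pzAlgebra K).

HB.instance Definition _ := GRing.Lmodule.copy (regbim R) R.
HB.instance Definition _ := Lmodule_isBimodule.Build K R (regbim R)
  (fun r s t => mulrDl r s t) (fun r s t => mulrDr r s t)
  (fun k r s => esym (pzscalerAl k r s)) (fun r => mul1r r)
  (fun r s t => esym (mulrA r s t))
  (fun r s t => mulrDl r s t) (fun r s t => mulrDr r s t)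
  (fun k r s => esym (pzscalerAr k r s)) (fun r => mulr1 r)
  (fun r s t => mulrA r s t) (fun r s t => esym (mulrA r s t)).

End RegularBimodule.

Definition dual (K : fieldType) (V : lmodType K) : Type := {linear V -> K^o}.

Section DualLmodule.
Variables (K : fieldType) (V : lmodType K).

HB.instance Definition _ := gen_eqMixin (dual V).
HB.instance Definition _ := gen_choiceMixin (dual V).

Definition dual_fun (f : dual V) : V -> K :=
  (f : {linear V -> K^o}) : V -> K^o.
Coercion dual_fun : dual >-> Funclass.

Lemma dualP (f g : dual V) : f =1 g -> f = g.
Proof.
case: f g => [f [[fD] [fZ]]] [g [[gD] [gZ]]] /funext fg.
have {}fg : f = g by [].
move: gD gZ; case: _ / fg => gD gZ.
by rewrite (Prop_irrelevance gD fD) (Prop_irrelevance gZ fZ).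
Qed.

Lemma dual_funP (f : dual V) : linear (f : V -> K^o).
Proof. by move=> k x y; rewrite /dual_fun linearP. Qed.

Definition mkdual (f : V -> K) (fP : linear (f : V -> K^o)) : dual V :=
  HB.pack_for {linear V -> K^o} (f : V -> K^o)
    (GRing.isLinear.Build K V K^o *:%R f fP).

Let zero_linear : linear ((fun=> 0) : V -> K^o).
Proof. by move=> k x y; rewrite scaler0 addr0. Qed.
Let opp_linear (f : dual V) : linear ((fun x => - f x) : V -> K^o).
Proof. by move=> k x y; rewrite dual_funP opprD scalerN. Qed.
Let add_linear (f g : dual V) : linear ((fun x => f x + g x) : V -> K^o).
Proof. by move=> k x y; rewrite !dual_funP scalerDr addrACA. Qed.
Let scale_linear (c : K) (f : dual V) : linear ((fun x => c * f x) : V -> K^o).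
Proof.
move=> k x y; rewrite dual_funP mulrDr; congr (_ + _).
by rewrite /GRing.scale /= mulrCA.
Qed.

Definition dual_zero := mkdual zero_linear.
Definition dual_opp f := mkdual (opp_linear f).
Definition dual_add f g := mkdual (add_linear f g).
Definition dual_scale c f := mkdual (scale_linear c f).

Let dual_addA : associative dual_add.
Proof. by move=> f g h; apply: dualP => x; apply: addrA. Qed.
Let dual_addC : commutative dual_add.
Proof. by move=> f g; apply: dualP => x; apply: addrC. Qed.
Let dual_add0 : left_id dual_zero dual_add.
Proof. by move=> f; apply: dualP => x; apply: add0r. Qed.
Let dual_addN : left_inverse dual_zero dual_opp dual_add.
Proof. by move=> f; apply: dualP => x; apply: addNr. Qed.
HB.instance Definition _ := GRing.isZmodule.Build (dual V)
  dual_addA dual_addC dual_add0 dual_addN.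

Let dual_scaleA a b f : dual_scale a (dual_scale b f) = dual_scale (a * b) f.
Proof. by apply: dualP => x; apply: mulrA. Qed.
Let dual_scale1 : left_id 1 dual_scale.
Proof. by move=> f; apply: dualP => x; apply: mul1r. Qed.
Let dual_scaleDr : right_distributive dual_scale +%R.
Proof. by move=> a f g; apply: dualP => x; apply: mulrDr. Qed.
Let dual_scaleDl f : {morph dual_scale^~ f : a b / a + b}.
Proof. by move=> a b; apply: dualP => x; apply: mulrDl. Qed.
HB.instance Definition _ := GRing.Zmodule_isLmodule.Build K (dual V)
  dual_scaleA dual_scale1 dual_scaleDr dual_scaleDl.

End DualLmodule.

Section DualBimodule.
Variables (K : fieldType) (A : pzAlgebra K).
Implicit Types (f g : dual A) (a b : A) (k : K).

Let lact_linear a f : linear ((fun s => f (s * a)) : A -> K^o).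
Proof. by move=> k x y; rewrite mulrDl -pzscalerAl dual_funP. Qed.
Let ract_linear f a : linear ((fun s => f (a * s)) : A -> K^o).
Proof. by move=> k x y; rewrite mulrDr -pzscalerAr dual_funP. Qed.

Definition dual_lact a f : dual A := mkdual (lact_linear a f).
Definition dual_ract f a : dual A := mkdual (ract_linear f a).

Let dfD f x y : f (x + y) = f x + f y.
Proof. by have := dual_funP f 1 x y; rewrite !scale1r. Qed.
Let dfZ f k x : f (k *: x) = k * f x.
Proof. exact: (linearZ_LR (f : {linear A -> K^o})). Qed.

Let lactDl a b f : dual_lact (a + b) f = dual_lact a f + dual_lact b f.
Proof. by apply: dualP => x; rewrite /dual_fun/= mulrDr; apply: dfD. Qed.
Let lactDr a f g : dual_lact a (f + g) = dual_lact a f + dual_lact a g.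
Proof. by apply: dualP. Qed.
Let lactZl k a f : dual_lact (k *: a) f = k *: dual_lact a f.
Proof. by apply: dualP => x; rewrite /dual_fun/= -pzscalerAr; apply: dfZ. Qed.
Let lact1 f : dual_lact 1 f = f.
Proof. by apply: dualP => x; rewrite /dual_fun/= mulr1. Qed.
Let lactA a b f : dual_lact (a * b) f = dual_lact a (dual_lact b f).
Proof. by apply: dualP => x; rewrite /dual_fun/= mulrA. Qed.
Let ractDl f g a : dual_ract (f + g) a = dual_ract f a + dual_ract g a.
Proof. by apply: dualP. Qed.
Let ractDr f a b : dual_ract f (a + b) = dual_ract f a + dual_ract f b.
Proof. by apply: dualP => x; rewrite /dual_fun/= mulrDl; apply: dfD. Qed.
Let ractZr k f a : dual_ract f (k *: a) = k *: dual_ract f a.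
Proof. by apply: dualP => x; rewrite /dual_fun/= -pzscalerAl; apply: dfZ. Qed.
Let ract1 f : dual_ract f 1 = f.
Proof. by apply: dualP => x; rewrite /dual_fun/= mul1r. Qed.
Let ractA f a b : dual_ract f (a * b) = dual_ract (dual_ract f a) b.
Proof. by apply: dualP => x; rewrite /dual_fun/= mulrA. Qed.
Let lractA a f b :
  dual_ract (dual_lact a f) b = dual_lact a (dual_ract f b).
Proof. by apply: dualP => x; rewrite /dual_fun/= mulrA. Qed.

HB.instance Definition _ := Lmodule_isBimodule.Build K A (dual A)
  lactDl lactDr lactZl lact1 lactA ractDl ractDr ractZr ract1 ractA lractA.

Lemma dual_lactE a f s : (lact a f : dual A) s = f (s * a).
Proof. by []. Qed.

Lemma dual_ractE f a s : (ract f a : dual A) s = f (a * s).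
Proof. by []. Qed.

End DualBimodule.

Section Quotient.
Variables (K : fieldType) (V : lmodType K).

Record submodule := Submodule {
  sub_mem :> V -> Prop;
  sub_mem0 : sub_mem 0;
  sub_memD : forall x y, sub_mem x -> sub_mem y -> sub_mem (x + y);
  sub_memZ : forall (k : K) x, sub_mem x -> sub_mem (k *: x)
}.

Inductive spanned (G : V -> Prop) : V -> Prop :=
| spanned_gen x of G x : spanned G x
| spanned0 : spanned G 0
| spannedD x y of spanned G x & spanned G y : spanned G (x + y)
| spannedZ (k : K) x of spanned G x : spanned G (k *: x).

Definition span_of (G : V -> Prop) : submodule :=
  Submodule (spanned0 G) (@spannedD G) (@spannedZ G).

Variable S : submodule.

Definition quot_rel (x y : V) : bool := `[< S (x - y) >].

Lemma sub_memN x : S x -> S (- x).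
Proof. by rewrite -scaleN1r; apply: sub_memZ. Qed.

Lemma quot_rel_equiv : equiv_class_of quot_rel.
Proof.
split=> [x|x y|y x z]; rewrite /quot_rel.
- by apply/asboolP; rewrite subrr; apply: sub_mem0.
- by apply/asboolP/asboolP => /sub_memN; rewrite opprB.
move=> /asboolP Sxy /asboolP Syz; apply/asboolP.
by rewrite -[x](subrK y) -addrA; apply: sub_memD.
Qed.

Canonical quot_rel_equivRel := EquivRelPack quot_rel_equiv.
Canonical quot_rel_encModRel := defaultEncModRel quot_rel.

Definition quotmod : Type := {eq_quot quot_rel}.
HB.instance Definition _ := Choice.on quotmod.
HB.instance Definition _ : EqQuotient V quot_rel quotmod :=
  EqQuotient.on quotmod.

End Quotient.

HB.lock Definition qproj (K : fieldType) (V : lmodType K) (S : submodule V)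
  (x : V) : quotmod S := \pi_(quotmod S) x.

HB.lock Definition quot_add (K : fieldType) (V : lmodType K)
  (S : submodule V) (p q : quotmod S) : quotmod S := qproj S (repr p + repr q).

HB.lock Definition quot_opp (K : fieldType) (V : lmodType K)
  (S : submodule V) (p : quotmod S) : quotmod S := qproj S (- repr p).

HB.lock Definition quot_scale (K : fieldType) (V : lmodType K)
  (S : submodule V) (k : K) (p : quotmod S) : quotmod S :=
  qproj S (k *: repr p).

Section QuotientLmodule.
Variables (K : fieldType) (V : lmodType K) (S : submodule V).
Local Notation quotmod := (quotmod S).
Local Notation qproj := (qproj S).
Local Notation quot_add := (@quot_add K V S).
Local Notation quot_opp := (@quot_opp K V S).
Local Notation quot_scale := (@quot_scale K V S).

Lemma qproj_eqP x y : qproj x = qproj y <-> S (x - y).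
Proof.
rewrite qproj.unlock; split; last by move=> Sxy; apply/eqmodP/asboolP.
by move/eqmodP/asboolP.
Qed.

Lemma qproj_surj (q : quotmod) : exists x, q = qproj x.
Proof. by exists (repr q); rewrite qproj.unlock reprK. Qed.

Lemma qrepr x : S (repr (qproj x) - x).
Proof. by apply/qproj_eqP; rewrite qproj.unlock reprK. Qed.

Lemma quot_addE x y : quot_add (qproj x) (qproj y) = qproj (x + y).
Proof.
rewrite quot_add.unlock; apply/qproj_eqP; rewrite opprD addrACA.
by apply: sub_memD; apply: qrepr.
Qed.
Lemma quot_oppE x : quot_opp (qproj x) = qproj (- x).
Proof.
rewrite quot_opp.unlock; apply/qproj_eqP; rewrite -opprD.
exact/sub_memN/qrepr.
Qed.
Lemma quot_scaleE k x : quot_scale k (qproj x) = qproj (k *: x).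
Proof.
rewrite quot_scale.unlock; apply/qproj_eqP; rewrite -scalerBr.
exact/sub_memZ/qrepr.
Qed.

Let qaddA : associative quot_add.
Proof.
move=> p q r; have [x ->] := qproj_surj p; have [y ->] := qproj_surj q.
by have [z ->] := qproj_surj r; rewrite !quot_addE addrA.
Qed.
Let qaddC : commutative quot_add.
Proof.
move=> p q; have [x ->] := qproj_surj p; have [y ->] := qproj_surj q.
by rewrite !quot_addE addrC.
Qed.
Let qadd0 : left_id (qproj 0) quot_add.
Proof. by move=> p; have [x ->] := qproj_surj p; rewrite quot_addE add0r. Qed.
Let qaddN : left_inverse (qproj 0) quot_opp quot_add.
Proof.
by move=> p; have [x ->] := qproj_surj p; rewrite quot_oppE quot_addE addNr.
Qed.
HB.instance Definition _ := GRing.isZmodule.Build quotmod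
  qaddA qaddC qadd0 qaddN.

Let qscaleA a b p : quot_scale a (quot_scale b p) = quot_scale (a * b) p.
Proof. by have [x ->] := qproj_surj p; rewrite !quot_scaleE scalerA. Qed.
Let qscale1 : left_id 1 quot_scale.
Proof. by move=> p; have [x ->] := qproj_surj p; rewrite quot_scaleE scale1r. Qed.
Let qscaleDr : right_distributive quot_scale +%R.
Proof.
move=> a p q; have [x ->] := qproj_surj p; have [y ->] := qproj_surj q.
by rewrite [_ + _]quot_addE !quot_scaleE [RHS]quot_addE scalerDr.
Qed.
Let qscaleDl p : {morph quot_scale^~ p : a b / a + b}.
Proof.
move=> a b; have [x ->] := qproj_surj p.
by rewrite !quot_scaleE [RHS]quot_addE scalerDl.
Qed.
HB.instance Definition _ := GRing.Zmodule_isLmodule.Build K quotmod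
  qscaleA qscale1 qscaleDr qscaleDl.

Lemma qproj_is_linear : linear qproj.
Proof.
move=> k x y; rewrite -[k *: qproj x]/(quot_scale _ _) -[RHS]/(quot_add _ _).
by rewrite quot_scaleE quot_addE.
Qed.
HB.instance Definition _ := GRing.isLinear.Build K V quotmod *:%R qproj
  qproj_is_linear.

Lemma qprojD x y : qproj (x + y) = qproj x + qproj y.
Proof. exact: raddfD. Qed.
Lemma qprojZ k x : qproj (k *: x) = k *: qproj x.
Proof. exact: linearZ. Qed.

Lemma qproj_eq0 x : qproj x = 0 <-> S x.
Proof. by rewrite -{2}[x]subr0 -qproj_eqP linear0. Qed.

End QuotientLmodule.

Section QuotientAlgebra.
Variables (K : fieldType) (A : pzAlgebra K) (G : A -> Prop).

Inductive in_ideal : A -> Prop :=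
| in_ideal_gen x of G x : in_ideal x
| in_ideal0 : in_ideal 0
| in_idealD x y of in_ideal x & in_ideal y : in_ideal (x + y)
| in_idealMl a x of in_ideal x : in_ideal (a * x)
| in_idealMr x a of in_ideal x : in_ideal (x * a).

Lemma in_idealZ (k : K) x : in_ideal x -> in_ideal (k *: x).
Proof.
by move=> Ix; rewrite -[x]mul1r pzscalerAl; apply: in_idealMl.
Qed.

Definition ideal_of : submodule A := Submodule in_ideal0 in_idealD in_idealZ.

End QuotientAlgebra.

HB.lock Definition quotalg_mul (K : fieldType) (A : pzAlgebra K)
  (G : A -> Prop) (p q : quotmod (ideal_of G)) : quotmod (ideal_of G) :=
  qproj (ideal_of G) (repr p * repr q).

Section QuotientAlgebraMul.
Variables (K : fieldType) (A : pzAlgebra K) (G : A -> Prop).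
Local Notation Q := (quotmod (ideal_of G)).
Local Notation pi := (@qproj K A (ideal_of G)).
Local Notation quotalg_mul := (@quotalg_mul K A G).

Lemma quotalg_mulE (x y : A) : quotalg_mul (pi x) (pi y) = pi (x * y).
Proof.
rewrite quotalg_mul.unlock; apply/qproj_eqP; set x' := repr _; set y' := repr _.
have -> : x' * y' - x * y = (x' - x) * y' + x * (y' - y).
  by rewrite mulrBl mulrBr addrA subrK.
by apply: in_idealD; [apply: in_idealMr | apply: in_idealMl];
  exact: (@qrepr K A (ideal_of G)).
Qed.

Let qmulA : associative quotalg_mul.
Proof.
move=> p q r; have [x ->] := qproj_surj p; have [y ->] := qproj_surj q.
by have [z ->] := qproj_surj r; rewrite !quotalg_mulE mulrA.
Qed.
Let qmul1 : left_id (pi 1) quotalg_mul.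
Proof. by move=> p; have [x ->] := qproj_surj p; rewrite quotalg_mulE mul1r. Qed.
Let q1mul : right_id (pi 1) quotalg_mul.
Proof. by move=> p; have [x ->] := qproj_surj p; rewrite quotalg_mulE mulr1. Qed.
Let qmulDl : left_distributive quotalg_mul +%R.
Proof.
move=> p q r; have [x ->] := qproj_surj p; have [y ->] := qproj_surj q.
by have [z ->] := qproj_surj r; rewrite -qprojD !quotalg_mulE -qprojD mulrDl.
Qed.
Let qmulDr : right_distributive quotalg_mul +%R.
Proof.
move=> p q r; have [x ->] := qproj_surj p; have [y ->] := qproj_surj q.
by have [z ->] := qproj_surj r; rewrite -qprojD !quotalg_mulE -qprojD mulrDr.
Qed.
Let qscalAl (k : K) p q : k *: quotalg_mul p q = quotalg_mul (k *: p) q.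
Proof.
have [x ->] := qproj_surj p; have [y ->] := qproj_surj q.
by rewrite -[k *: qproj _ _]qprojZ !quotalg_mulE -qprojZ pzscalerAl.
Qed.
Let qscalAr (k : K) p q : k *: quotalg_mul p q = quotalg_mul p (k *: q).
Proof.
have [x ->] := qproj_surj p; have [y ->] := qproj_surj q.
by rewrite -[k *: qproj _ _]qprojZ !quotalg_mulE -qprojZ pzscalerAr.
Qed.

Definition quotalg : pzAlgebra K :=
  PzAlgebra qmulA qmul1 q1mul qmulDl qmulDr qscalAl qscalAr.

Definition quotalg_proj (x : A) : quotalg := pi x.

Lemma quotalg_proj_linear : linear quotalg_proj.
Proof. by move=> k x y; apply: etrans (qprojD _ _ _) _; rewrite qprojZ. Qed.

Lemma quotalg_projM : {morph quotalg_proj : x y / x * y}.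
Proof. by move=> x y; apply: esym; apply: quotalg_mulE. Qed.

Lemma quotalg_proj1 : quotalg_proj 1 = 1.
Proof. by []. Qed.

Lemma quotalg_proj_surj (q : quotalg) : exists x, q = quotalg_proj x.
Proof. exact: qproj_surj. Qed.

Lemma quotalg_proj_eq0 x : quotalg_proj x = 0 <-> in_ideal G x.
Proof. exact: (@qproj_eq0 K A (ideal_of G)). Qed.

End QuotientAlgebraMul.

Section Tensor.
Variables (K : fieldType) (R : pzAlgebra K) (V W : bimodType R).

Local Notation free := {malg K[(V * W)%type]}.

Inductive tensor_rel : free -> Prop :=
| tensor_relDl v v' w :
    tensor_rel (<< (v + v', w) >> - << (v, w) >> - << (v', w) >>)
| tensor_relDr v w w' :
    tensor_rel (<< (v, w + w') >> - << (v, w) >> - << (v, w') >>)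
| tensor_relZ (k : K) v w :
    tensor_rel (<< (k *: v, w) >> - k *: << (v, w) >>)
| tensor_relA v (r : R) w :
    tensor_rel (<< (ract v r, w) >> - << (v, lact r w) >>).

Definition tensor : Type := quotmod (span_of tensor_rel).
HB.instance Definition _ := GRing.Lmodule.on tensor.

Definition balanced (U : lmodType K) (f : V -> W -> U) : Prop :=
  [/\ forall w, linear (f^~ w), forall v, linear (f v)
    & forall v (r : R) w, f (ract v r) w = f v (lact r w)].

End Tensor.

HB.lock Definition tens (K : fieldType) (R : pzAlgebra K) (V W : bimodType R)
  (v : V) (w : W) : tensor V W :=
  qproj (span_of (@tensor_rel K R V W)) << (v, w) >>.

(* The linear map induced by f on V (x)_R W; meaningful for balanced f. *)
HB.lock Definition tens_lift (K : fieldType) (R : pzAlgebra K)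
  (V W : bimodType R) (U : lmodType K) (f : V -> W -> U) (t : tensor V W) : U :=
  \sum_(k <- msupp (repr t)) (repr t)@_k *: f k.1 k.2.

Section TensorTheory.
Variables (K : fieldType) (R : pzAlgebra K) (V W : bimodType R).
Local Notation free := {malg K[(V * W)%type]}.
Local Notation tensor := (tensor V W).
Local Notation tensor_rel := (@tensor_rel K R V W).
Local Notation tens := (@tens K R V W).
Local Notation tens_lift := (@tens_lift K R V W).

Lemma tensDl v v' w : tens (v + v') w = tens v w + tens v' w.
Proof.
rewrite tens.unlock; apply: etrans (qprojD _ _ _); apply/qproj_eqP.
rewrite opprD addrA.
exact/spanned_gen/tensor_relDl.
Qed.

Lemma tensDr v w w' : tens v (w + w') = tens v w + tens v w'.
Proof.
rewrite tens.unlock; apply: etrans (qprojD _ _ _); apply/qproj_eqP.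
rewrite opprD addrA.
exact/spanned_gen/tensor_relDr.
Qed.

Lemma tensZl k v w : tens (k *: v) w = k *: tens v w.
Proof.
rewrite tens.unlock; apply: etrans (qprojZ _ _ _); apply/qproj_eqP.
exact/spanned_gen/tensor_relZ.
Qed.

Lemma tensA v (r : R) w : tens (ract v r) w = tens v (lact r w).
Proof. rewrite tens.unlock; apply/qproj_eqP; exact/spanned_gen/tensor_relA. Qed.

Lemma tensZr k v w : tens v (k *: w) = k *: tens v w.
Proof.
have -> : k *: w = lact (k *: (1 : R)) w by rewrite lactZl lact1.
by rewrite -tensA ractZr ract1 tensZl.
Qed.

Section Lift.
Variables (U : lmodType K) (f : V -> W -> U).

Let free_lift (g : free) : U := \sum_(k <- msupp g) g@_k *: f k.1 k.2.

Let free_liftE (d : {fset V * W}) (g : free) :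
  (msupp g `<=` d)%fset -> free_lift g = \sum_(k <- d) g@_k *: f k.1 k.2.
Proof.
move=> gd; rewrite /free_lift (big_fset_incl _ gd)// => k _ kg.
by rewrite mcoeff_outdom ?scale0r.
Qed.

Let free_lift_linear : linear free_lift.
Proof.
move=> c g h; pose d := (msupp g `|` msupp h)%fset.
have gd : (msupp g `<=` d)%fset by apply: fsubsetUl.
have hd : (msupp h `<=` d)%fset by apply: fsubsetUr.
have cgd : (msupp (c *: g) `<=` d)%fset.
  by apply: fsubset_trans (msuppZ_le _ _) gd.
have ghd : (msupp (c *: g + h) `<=` d)%fset.
  by apply: fsubset_trans (msuppD_le _ _) _; rewrite fsubUset cgd.
rewrite (free_liftE gd) (free_liftE hd) (free_liftE ghd) scaler_sumr -big_split.
by apply: eq_bigr => k _; rewrite mcoeffD mcoeffZ scalerDl scalerA.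
Qed.

Let free_liftD g h : free_lift (g + h) = free_lift g + free_lift h.
Proof. by have := free_lift_linear 1 g h; rewrite !scale1r. Qed.
Let free_lift0 : free_lift 0 = 0.
Proof. by rewrite /free_lift msupp0 big_seq_fset0. Qed.
Let free_liftZ c g : free_lift (c *: g) = c *: free_lift g.
Proof. by have := free_lift_linear c g 0; rewrite !addr0 free_lift0 addr0. Qed.
Let free_liftN g : free_lift (- g) = - free_lift g.
Proof.
have -> : - g = (-1 : K) *: g by rewrite scaleN1r.
by rewrite free_liftZ scaleN1r.
Qed.
Let free_liftU v w : free_lift << (v, w) >> = f v w.
Proof.
by rewrite (free_liftE msuppU_le) big_seq_fset1 mcoeffUU scale1r.
Qed.

Hypothesis fP : balanced f.

Let free_lift_span g : spanned tensor_rel g -> free_lift g = 0.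
Proof.
have [fl fr fA] := fP.
have flD w v v' : f (v + v') w = f v w + f v' w.
  by have := fl w 1 v v'; rewrite !scale1r.
have frD v w w' : f v (w + w') = f v w + f v w'.
  by have := fr v 1 w w'; rewrite !scale1r.
elim=> {g} [g|||].
- case=> [v v' w|v w w'|k v w|v r w];
    rewrite !(free_liftD, free_liftN, free_liftZ, free_liftU).
  + by rewrite flD addrAC addrK subrr.
  + by rewrite frD addrAC addrK subrr.
  + have f0w : f 0 w = 0 by apply: (addIr (f 0 w)); rewrite -flD !add0r.
    by have := fl w k v 0; rewrite !addr0 => ->; rewrite f0w addr0 subrr.
  + by rewrite fA subrr.
- exact: free_lift0.
- by move=> g h _ g0 _ h0; rewrite free_liftD g0 h0 addr0.
- by move=> k g _ g0; rewrite free_liftZ g0 scaler0.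
Qed.

Let tens_lift_proj g : tens_lift f (qproj (span_of tensor_rel) g) = free_lift g.
Proof.
rewrite tens_lift.unlock; apply/eqP; rewrite -subr_eq0.
rewrite -[X in X - _]/(free_lift _) -free_liftN -free_liftD; apply/eqP.
by apply: free_lift_span; apply: (@qrepr K free (span_of tensor_rel)).
Qed.

Lemma tens_lift_tens v w : tens_lift f (tens v w) = f v w.
Proof. by rewrite tens.unlock tens_lift_proj free_liftU. Qed.

Lemma tens_lift_linear : linear (tens_lift f).
Proof.
move=> k s t; have [g ->] := qproj_surj s; have [h ->] := qproj_surj t.
by rewrite -linearP !tens_lift_proj free_lift_linear.
Qed.

End Lift.

Lemma tens_ind (P : tensor -> Prop) :
  (forall v w, P (tens v w)) -> (forall s t, P s -> P t -> P (s + t)) ->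
  forall t, P t.
Proof.
move=> Pt PD t; have [g ->] := qproj_surj t; rewrite (monalgE g).
have P0 : P 0.
  by rewrite -(scale0r (tens 0 0)) -tensZl; apply: Pt.
rewrite raddf_sum; apply: (big_ind P P0 PD) => -[v w] _.
have E : qproj (span_of tensor_rel) << g@_(v, w) *g (v, w) >>
          = tens (g@_(v, w) *: v) w.
  rewrite tensZl tens.unlock; apply: etrans (qprojZ _ _ _); congr (qproj _ _).
  by apply/malgP => k; rewrite mcoeffZ !mcoeffU mulrnAr mulr1.
exact: (eq_ind_r P (Pt _ _) E).
Qed.

Lemma tens_lift_uniq (U : lmodType K) (f : V -> W -> U) (F : tensor -> U) :
    balanced f -> {morph F : s t / s + t} ->
  (forall v w, F (tens v w) = f v w) -> F =1 tens_lift f.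
Proof.
move=> fP FD Ff; apply: tens_ind => [v w|s t Fs Ft].
  by rewrite Ff tens_lift_tens.
have := tens_lift_linear fP 1 s t; rewrite !scale1r => ->.
by rewrite FD Fs Ft.
Qed.

End TensorTheory.

HB.lock Definition tensor_lact (K : fieldType) (R : pzAlgebra K)
  (V W : bimodType R) (r : R) (t : tensor V W) : tensor V W :=
  tens_lift (fun v w => tens (lact r v) w) t.

HB.lock Definition tensor_ract (K : fieldType) (R : pzAlgebra K)
  (V W : bimodType R) (t : tensor V W) (r : R) : tensor V W :=
  tens_lift (fun v w => tens v (ract w r)) t.

Section TensorBimodule.
Variables (K : fieldType) (R : pzAlgebra K) (V W : bimodType R).
Implicit Types (v : V) (w : W) (r s : R) (t u : tensor V W) (k : K).

Lemma tens_linearl w : linear (fun v => tens v w).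
Proof. by move=> k v v'; rewrite tensDl tensZl. Qed.

Lemma tens_linearr v : linear (tens v : W -> tensor V W).
Proof. by move=> k w w'; rewrite tensDr tensZr. Qed.

Let lact_balanced r : balanced (fun v w => tens (lact r v) w).
Proof.
split=> [w k v v'|v|v s w].
- by rewrite lactDr lactZr tens_linearl.
- exact: tens_linearr.
- by rewrite -lractA tensA.
Qed.

Let ract_balanced r : balanced (fun v w => tens v (ract w r)).
Proof.
split=> [w|v k w w'|v s w].
- exact: tens_linearl.
- by rewrite ractDl ractZl tens_linearr.
- by rewrite lractA tensA.
Qed.

Let lactE r v w : tensor_lact r (tens v w) = tens (lact r v) w.
Proof. by rewrite tensor_lact.unlock (tens_lift_tens (lact_balanced r)). Qed.
Let ractE v w r : tensor_ract (tens v w) r = tens v (ract w r).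
Proof. by rewrite tensor_ract.unlock (tens_lift_tens (ract_balanced r)). Qed.

Let lactD r t u : tensor_lact r (t + u) = tensor_lact r t + tensor_lact r u.
Proof.
rewrite tensor_lact.unlock.
by have := tens_lift_linear (lact_balanced r) 1 t u; rewrite !scale1r.
Qed.
Let ractD t u r : tensor_ract (t + u) r = tensor_ract t r + tensor_ract u r.
Proof.
rewrite tensor_ract.unlock.
by have := tens_lift_linear (ract_balanced r) 1 t u; rewrite !scale1r.
Qed.

Let lactDl r s t : tensor_lact (r + s) t = tensor_lact r t + tensor_lact s t.
Proof.
elim/tens_ind: t => [v w|t u IHt IHu]; first by rewrite !lactE lactDl tensDl.
by rewrite !lactD IHt IHu addrACA.
Qed.
Let lactZl k r t : tensor_lact (k *: r) t = k *: tensor_lact r t.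
Proof.
elim/tens_ind: t => [v w|t u IHt IHu]; first by rewrite !lactE lactZl tensZl.
by rewrite !lactD IHt IHu scalerDr.
Qed.
Let lact1 t : tensor_lact 1 t = t.
Proof.
elim/tens_ind: t => [v w|t u IHt IHu]; first by rewrite lactE lact1.
by rewrite lactD IHt IHu.
Qed.
Let lactA r s t : tensor_lact (r * s) t = tensor_lact r (tensor_lact s t).
Proof.
elim/tens_ind: t => [v w|t u IHt IHu]; first by rewrite !lactE lactA.
by rewrite !lactD IHt IHu.
Qed.
Let ractDr t r s : tensor_ract t (r + s) = tensor_ract t r + tensor_ract t s.
Proof.
elim/tens_ind: t => [v w|t u IHt IHu]; first by rewrite !ractE ractDr tensDr.
by rewrite !ractD IHt IHu addrACA.
Qed.
Let ractZr k t r : tensor_ract t (k *: r) = k *: tensor_ract t r.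
Proof.
elim/tens_ind: t => [v w|t u IHt IHu]; first by rewrite !ractE ractZr tensZr.
by rewrite !ractD IHt IHu scalerDr.
Qed.
Let ract1 t : tensor_ract t 1 = t.
Proof.
elim/tens_ind: t => [v w|t u IHt IHu]; first by rewrite ractE ract1.
by rewrite ractD IHt IHu.
Qed.
Let ractA t r s : tensor_ract t (r * s) = tensor_ract (tensor_ract t r) s.
Proof.
elim/tens_ind: t => [v w|t u IHt IHu]; first by rewrite !ractE ractA.
by rewrite !ractD IHt IHu.
Qed.
Let lractA r t s :
  tensor_ract (tensor_lact r t) s = tensor_lact r (tensor_ract t s).
Proof.
elim/tens_ind: t => [v w|t u IHt IHu]; first by rewrite lactE !ractE lactE.
by rewrite lactD !ractD lactD IHt IHu.
Qed.

HB.instance Definition _ := Lmodule_isBimodule.Build K R (tensor V W)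
  lactDl lactD lactZl lact1 lactA ractD ractDr ractZr ract1 ractA lractA.

Lemma lact_tens r v w : lact r (tens v w) = tens (lact r v) w.
Proof. exact: lactE. Qed.

Lemma ract_tens v w r : ract (tens v w) r = tens v (ract w r).
Proof. exact: ractE. Qed.

End TensorBimodule.

Section TensorPowers.
Variables (K : fieldType) (R : pzAlgebra K) (M : bimodType R).

(* Tensor powers over R, with the 0th one being R and the first one M. *)
Fixpoint tpow (n : nat) : bimodType R :=
  match n with
  | 0 => regbim R
  | n'.+1 =>
    match n' with
    | 0 => M
    | _.+1 => tensor M (tpow n')
    end
  end.

(* The pure tensor m_0 (x) ... (x) m_(n-1). *)
Fixpoint tpure (n : nat) : ('I_n -> M) -> tpow n :=
  match n return ('I_n -> M) -> tpow n with
  | 0 => fun=> 1 : R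
  | n'.+1 =>
    match n' return
      (('I_n' -> M) -> tpow n') -> ('I_n'.+1 -> M) -> tpow n'.+1 with
    | 0 => fun _ m => m ord0
    | _.+1 => fun tpure' m => tens (m ord0) (tpure' (fun i => m (lift ord0 i)))
    end (@tpure n')
  end.

(* m (x) x, for n = 0 through the identification of M (x)_R R with M. *)
Definition tcons (m : M) (n : nat) : tpow n -> tpow n.+1 :=
  match n return tpow n -> tpow n.+1 with
  | 0 => fun r => ract m r
  | _.+1 => fun x => tens m x
  end.

Lemma tcons_linearr m n : linear (@tcons m n).
Proof.
case: n => [|n] k x y; last exact: tens_linearr.
by rewrite /= ractDr ractZr.
Qed.

Lemma tcons_linearl n (x : tpow n) : linear (fun m => tcons m x).
Proof.
case: n x => [|n] x k m m'; last exact: tens_linearl.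
by rewrite /= ractDl ractZl.
Qed.

Lemma tcons0 m n : tcons m (0 : tpow n) = 0.
Proof.
by have := tcons_linearr m (-1) 0 (0 : tpow n); rewrite !scaleN1r !addNr.
Qed.

Lemma tpow_ind n (P : tpow n.+1 -> Prop) :
  (forall m x, P (tcons m x)) -> (forall x y, P x -> P y -> P (x + y)) ->
  forall x, P x.
Proof.
case: n P => [|n] P Pm PD x; last exact: tens_ind Pm PD x.
by have := Pm x 1; rewrite /= ract1.
Qed.

Lemma tcons_ract m (r : R) n (x : tpow n) :
  tcons (ract m r) x = tcons m (lact r x).
Proof. by case: n x => [|n] x /=; [rewrite -ractA | rewrite tensA]. Qed.

Lemma lact_tcons (r : R) m n (x : tpow n) :
  lact r (tcons m x) = tcons (lact r m) x.
Proof. by case: n x => [|n] x /=; [rewrite lractA | rewrite lact_tens]. Qed.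

Lemma tpureS n (m : 'I_n.+1 -> M) :
  tpure m = tcons (m ord0) (tpure (fun i => m (lift ord0 i))).
Proof. by case: n m => [|n] m //=; rewrite ract1. Qed.

(* Elements of the direct sum of all tensor powers. *)
Record tensors := Tensors {
  tcomp :> forall i, tpow i;
  tcomp_fin : exists N, forall i, (N <= i)%N -> tcomp i = 0
}.

HB.instance Definition _ := gen_eqMixin tensors.
HB.instance Definition _ := gen_choiceMixin tensors.

Lemma tensorsP (f g : tensors) : (forall i, f i = g i) -> f = g.
Proof.
case: f g => [f fN] [g gN] /= fg0.
have fg : f = g by apply: functional_extensionality_dep.
by case: _ / fg gN => gN; rewrite (Prop_irrelevance gN fN).
Qed.

Let zero_fin : exists N, forall i, (N <= i)%N -> 0 = 0 :> tpow i.
Proof. by exists 0%N. Qed.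
Let opp_fin (f : tensors) :
  exists N, forall i, (N <= i)%N -> - f i = 0.
Proof. by have [N fN] := tcomp_fin f; exists N => i /fN ->; rewrite oppr0. Qed.
Let add_fin (f g : tensors) :
  exists N, forall i, (N <= i)%N -> f i + g i = 0.
Proof.
have [N fN] := tcomp_fin f; have [N' gN] := tcomp_fin g.
exists (maxn N N') => i; rewrite geq_max => /andP[/fN -> /gN ->].
by rewrite addr0.
Qed.
Let scale_fin (k : K) (f : tensors) :
  exists N, forall i, (N <= i)%N -> k *: f i = 0.
Proof. by have [N fN] := tcomp_fin f; exists N => i /fN ->; rewrite scaler0. Qed.

Definition tensors_zero := Tensors zero_fin.
Definition tensors_opp f := Tensors (opp_fin f).
Definition tensors_add f g := Tensors (add_fin f g).
Definition tensors_scale k f := Tensors (scale_fin k f).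

Let taddA : associative tensors_add.
Proof. by move=> f g h; apply: tensorsP => i; apply: addrA. Qed.
Let taddC : commutative tensors_add.
Proof. by move=> f g; apply: tensorsP => i; apply: addrC. Qed.
Let tadd0 : left_id tensors_zero tensors_add.
Proof. by move=> f; apply: tensorsP => i; apply: add0r. Qed.
Let taddN : left_inverse tensors_zero tensors_opp tensors_add.
Proof. by move=> f; apply: tensorsP => i; apply: addNr. Qed.
HB.instance Definition _ := GRing.isZmodule.Build tensors
  taddA taddC tadd0 taddN.

Let tscaleA a b f :
  tensors_scale a (tensors_scale b f) = tensors_scale (a * b) f.
Proof. by apply: tensorsP => i; apply: scalerA. Qed.
Let tscale1 : left_id 1 tensors_scale.
Proof. by move=> f; apply: tensorsP => i; apply: scale1r. Qed.
Let tscaleDr : right_distributive tensors_scale +%R.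
Proof. by move=> a f g; apply: tensorsP => i; apply: scalerDr. Qed.
Let tscaleDl f : {morph tensors_scale^~ f : a b / a + b}.
Proof. by move=> a b; apply: tensorsP => i; apply: scalerDl. Qed.
HB.instance Definition _ := GRing.Zmodule_isLmodule.Build K tensors
  tscaleA tscale1 tscaleDr tscaleDl.

Lemma tcompD (f g : tensors) i : (f + g) i = f i + g i. Proof. by []. Qed.
Lemma tcompZ (k : K) (f : tensors) i : (k *: f) i = k *: f i.
Proof. by []. Qed.
Lemma tcomp0 i : (0 : tensors) i = 0. Proof. by []. Qed.
Lemma tcomp_sum I (s : seq I) (P : pred I) (F : I -> tensors) i :
  (\sum_(j <- s | P j) F j) i = \sum_(j <- s | P j) F j i.
Proof. by apply: (big_morph (fun f : tensors => f i)). Qed.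

(* The inclusion of the homogeneous component of degree n. *)
Let tin_fun n (x : tpow n) i : tpow i :=
  if @eqP nat n i is ReflectT e then ecast i (tpow i) e x else 0.

Let tin_fun_fin n (x : tpow n) :
  exists N, forall i, (N <= i)%N -> tin_fun x i = 0.
Proof.
exists n.+1 => i ni; rewrite /tin_fun; case: eqP => // e.
by have /eqP := e; rewrite ltn_eqF.
Qed.

Definition tin n (x : tpow n) := Tensors (tin_fun_fin x).

Lemma tin_id n (x : tpow n) : tin x n = x.
Proof. by rewrite /= /tin_fun; case: eqP => // e; rewrite eq_axiomK. Qed.

Lemma tin_neq n (x : tpow n) i : n != i -> tin x i = 0.
Proof. by rewrite /= /tin_fun; case: eqP. Qed.

Lemma tin_linear n : linear (@tin n).
Proof.
move=> k x y; apply: tensorsP => i; rewrite tcompD tcompZ.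
have [<-|ni] := eqVneq n i; first by rewrite !tin_id.
by rewrite !tin_neq // scaler0 addr0.
Qed.

Lemma tensors_sum (f : tensors) N : (forall i, (N <= i)%N -> f i = 0) ->
  f = \sum_(i < N) tin (f i).
Proof.
move=> fN; apply: tensorsP => j; rewrite tcomp_sum.
have [jN|jN] := ltnP j N.
  rewrite (bigD1 (Ordinal jN)) // [tin _ _]tin_id big1 => [|i ij].
    by rewrite /= addr0.
  by rewrite tin_neq.
rewrite fN // big1 // => i _; rewrite tin_neq //.
by rewrite neq_ltn (leq_trans (ltn_ord i) jN).
Qed.

Let tlact_fin (r : R) (f : tensors) :
  exists N, forall i, (N <= i)%N -> lact r (f i) = 0.
Proof. by have [N fN] := tcomp_fin f; exists N => i /fN ->; rewrite lact0r. Qed.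

Definition tlact (r : R) (f : tensors) := Tensors (tlact_fin r f).

Let tshift_fun (m : M) (f : tensors) i : tpow i :=
  if i is i'.+1 then tcons m (f i') else 0.

Let tshift_fin (m : M) (f : tensors) :
  exists N, forall i, (N <= i)%N -> tshift_fun m f i = 0.
Proof.
by have [N fN] := tcomp_fin f; exists N.+1 => -[|i] // /fN /= ->; rewrite tcons0.
Qed.

Definition tshift (m : M) (f : tensors) := Tensors (tshift_fin m f).

(* Concatenation of a homogeneous element of degree i with an arbitrary one,
   given by (m_1 (x) ... (x) m_i) . f = m_1 . (... (m_i . f)). *)
Fixpoint tact (i : nat) : tpow i -> tensors -> tensors :=
  match i return tpow i -> tensors -> tensors with
  | 0 => tlact
  | i'.+1 =>
    match i' return
      (tpow i' -> tensors -> tensors) -> tpow i'.+1 -> tensors -> tensors with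
    | 0 => fun=> tshift
    | _.+1 => fun tact' x f => tens_lift (fun m y => tshift m (tact' y f)) x
    end (@tact i')
  end.

Lemma tshift_linearl f : linear (tshift^~ f).
Proof.
move=> k m m'; apply: tensorsP => -[|i]; first by rewrite /= scaler0 addr0.
exact: tcons_linearl.
Qed.

Lemma tshift_linearr m : linear (tshift m).
Proof.
move=> k f g; apply: tensorsP => -[|i]; first by rewrite /= scaler0 addr0.
exact: tcons_linearr.
Qed.

Lemma tshift_ract m (r : R) f : tshift (ract m r) f = tshift m (tlact r f).
Proof. by apply: tensorsP => -[|i] //=; rewrite tcons_ract. Qed.

Lemma tlact_tshift (r : R) m f : tlact r (tshift m f) = tshift (lact r m) f.
Proof. by apply: tensorsP => -[|i] /=; rewrite ?lact0r ?lact_tcons. Qed.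

Lemma tlactA (r s : R) f : tlact (r * s) f = tlact r (tlact s f).
Proof. by apply: tensorsP => i; apply: lactA. Qed.

Lemma tlact_linearl f : linear (tlact^~ f : R -> tensors).
Proof. by move=> k r s; apply: tensorsP => i /=; rewrite lactDl lactZl. Qed.

Lemma tlact_linearr (r : R) : linear (tlact r).
Proof. by move=> k f g; apply: tensorsP => i /=; rewrite lactDr lactZr. Qed.

Let tactP i : (forall f, linear (fun x : tpow i => tact x f)) /\
  forall f (r : R) (x : tpow i), tact (lact r x) f = tlact r (tact x f).
Proof.
elim: i => [|[|i] [IHl IHr]].
- by split=> [f|f r x]; [apply: tlact_linearl | apply: tlactA].
- split=> [f|f r x]; first exact: tshift_linearl.
  by rewrite /= tlact_tshift.
have fP f : balanced (fun m (y : tpow i.+1) => tshift m (tact y f)).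
  split=> [y k m m'|m k y y'|m r y]; first by rewrite tshift_linearl.
    by rewrite IHl tshift_linearr.
  by rewrite IHr tshift_ract.
have ll f := tens_lift_linear (fP f).
have lD f x y : tact (x + y : tpow i.+2) f = tact x f + tact y f.
  by have := ll f 1 x y; rewrite !scale1r.
split=> [|f r x]; first exact: ll.
elim/(@tpow_ind i.+1): x => [m y|x y IHx IHy].
  by rewrite lact_tcons /= !(tens_lift_tens (fP f)) tlact_tshift.
rewrite lactDr; apply: etrans (lD _ _ _) _.
apply: etrans (congr2 +%R IHx IHy) _.
apply: esym; apply: etrans (congr1 (tlact r) (lD _ _ _)) _.
by have := tlact_linearr r 1 (tact x f) (tact y f); rewrite !scale1r.
Qed.

Lemma tact_linearl i f : linear (fun x : tpow i => tact x f).
Proof. by have [] := tactP i. Qed.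

Lemma tact_lact i f (r : R) (x : tpow i) :
  tact (lact r x) f = tlact r (tact x f).
Proof. by have [] := tactP i. Qed.

Lemma tactDl i (x y : tpow i) f : tact (x + y) f = tact x f + tact y f.
Proof. by have := tact_linearl f 1 x y; rewrite !scale1r. Qed.

Lemma tact0l i f : tact (0 : tpow i) f = 0.
Proof.
by have := tactDl (0 : tpow i) 0 f; rewrite addr0 -{1}[tact _ _]addr0 => /addrI.
Qed.

Lemma tact_tcons m i (x : tpow i) f : tact (tcons m x) f = tshift m (tact x f).
Proof.
case: i x => [|i] x; first exact: tshift_ract.
have fP : balanced (fun m (y : tpow i.+1) => tshift m (tact y f)).
  split=> [y k m1 m2|m1 k y z|m1 r y]; first by rewrite tshift_linearl.
    by rewrite tact_linearl tshift_linearr.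
  by rewrite tact_lact tshift_ract.
exact: (tens_lift_tens fP).
Qed.

Lemma tact_linearr i (x : tpow i) : linear (tact x).
Proof.
elim: i x => [|i IH] x k f g; first exact: tlact_linearr.
elim/tpow_ind: x => [m x|x y IHx IHy].
  by rewrite !tact_tcons IH tshift_linearr.
by rewrite !tactDl IHx IHy scalerDr addrACA.
Qed.

Definition tbound (f : tensors) : nat := sval (cid (tcomp_fin f)).

Lemma tboundP (f : tensors) i : (tbound f <= i)%N -> f i = 0.
Proof. exact: (svalP (cid (tcomp_fin f))). Qed.

End TensorPowers.

HB.lock Definition tmul (K : fieldType) (R : pzAlgebra K) (M : bimodType R)
  (f g : tensors M) : tensors M :=
  \sum_(i < tbound f) tact (f i) g.

Section TensorAlgebra.
Variables (K : fieldType) (R : pzAlgebra K) (M : bimodType R).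
Local Notation tensors := (tensors M).
Local Notation tmul := (@tmul K R M).
Implicit Types (f g h : tensors) (k : K).

Lemma tmulE N f g :
  (forall i, (N <= i)%N -> f i = 0) -> tmul f g = \sum_(i < N) tact (f i) g.
Proof.
have wid n m : (n <= m)%N -> (forall i, (n <= i)%N -> f i = 0) ->
    \sum_(i < n) tact (f i) g = \sum_(i < m) tact (f i) g.
  move=> nm fn; rewrite (big_ord_widen m (fun i => tact (f i) g) nm).
  rewrite big_mkcond; apply: eq_bigr => i _.
  by case: ltnP => // /fn ->; rewrite tact0l.
move=> fN; rewrite tmul.unlock; have [le|/ltnW le] := leqP (tbound f) N.
  by apply: wid => // i; apply: tboundP.
by rewrite -(wid N _ le fN).
Qed.

Lemma tmul_tin i (x : tpow M i) g : tmul (tin x) g = tact x g.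
Proof.
rewrite (@tmulE i.+1) => [|j ij]; last by rewrite tin_neq // ltn_eqF.
rewrite big_ord_recr big1 => [|j _].
  by rewrite [LHS]add0r; congr (tact _ g); apply: tin_id.
have ji : i != j by rewrite gtn_eqF.
by rewrite tin_neq ?tact0l.
Qed.

Let tmul_linearl g : linear (tmul^~ g).
Proof.
move=> k f f'; pose N := maxn (tbound f) (tbound f').
have fN i : (N <= i)%N -> f i = 0.
  by rewrite geq_max => /andP[/tboundP].
have f'N i : (N <= i)%N -> f' i = 0.
  by rewrite geq_max => /andP[_ /tboundP].
have ffN i : (N <= i)%N -> (k *: f + f') i = 0.
  by move=> Ni; rewrite tcompD tcompZ fN // f'N // scaler0 addr0.
rewrite (tmulE _ fN) (tmulE _ f'N) (tmulE _ ffN) scaler_sumr -big_split /=.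
by apply: eq_bigr => i _; exact: tact_linearl.
Qed.

Let tmul_linearr f : linear (tmul f).
Proof.
move=> k g g'; rewrite !(tmulE _ (@tboundP _ _ _ f)) scaler_sumr -big_split.
by apply: eq_bigr => i _; rewrite tact_linearr.
Qed.

Let tmulDl : left_distributive tmul +%R.
Proof. by move=> f g h; have := tmul_linearl h 1 f g; rewrite !scale1r. Qed.
Let tmulDr : right_distributive tmul +%R.
Proof. by move=> f g h; have := tmul_linearr f 1 g h; rewrite !scale1r. Qed.
Let tmul0l g : tmul 0 g = 0.
Proof.
by have := tmulDl 0 0 g; rewrite addr0 -{1}[tmul _ _]addr0 => /addrI.
Qed.
Let tmul0r f : tmul f 0 = 0.
Proof.
by have := tmulDr f 0 0; rewrite addr0 -{1}[tmul _ _]addr0 => /addrI.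
Qed.
Let tscalAl k f g : k *: tmul f g = tmul (k *: f) g.
Proof. by have := tmul_linearl g k f 0; rewrite !addr0 tmul0l addr0. Qed.
Let tscalAr k f g : k *: tmul f g = tmul f (k *: g).
Proof. by have := tmul_linearr f k g 0; rewrite !addr0 tmul0r addr0. Qed.

Let tmul_tlact (r : R) f g : tmul (tlact r f) g = tlact r (tmul f g).
Proof.
have fN := @tboundP _ _ _ f.
rewrite (tmulE _ fN) (@tmulE (tbound f)) => [|i /fN /= ->]; last exact: lact0r.
rewrite (big_morph (tlact r) (id1 := 0) (op1 := +%R)).
- by apply: eq_bigr => i _; rewrite tact_lact.
- by move=> g1 g2; have := tlact_linearr r 1 g1 g2; rewrite !scale1r.
- by apply: tensorsP => i; apply: lact0r.
Qed.

Let tmul_tshift m f g : tmul (tshift m f) g = tshift m (tmul f g).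
Proof.
have fN := @tboundP _ _ _ f.
rewrite (tmulE _ fN) (@tmulE (tbound f).+1); last first.
  by case=> [|i] // /fN /= ->; rewrite tcons0.
rewrite big_ord_recl tact0l add0r (big_morph (tshift m) (id1 := 0) (op1 := +%R)).
- by apply: eq_bigr => i _; rewrite -tact_tcons.
- by move=> g1 g2; have := tshift_linearr m 1 g1 g2; rewrite !scale1r.
- by apply: tensorsP => -[|i] //=; rewrite tcons0.
Qed.

Let tmul_tact i (x : tpow M i) f g : tmul (tact x f) g = tact x (tmul f g).
Proof.
elim: i x => [|i IH] x; first exact: tmul_tlact.
elim/tpow_ind: x => [m x|x y IHx IHy].
  by rewrite !tact_tcons tmul_tshift IH.
by rewrite !tactDl tmulDl IHx IHy.
Qed.

Let tmul_suml I (s : seq I) (P : pred I) (F : I -> tensors) g :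
  tmul (\sum_(i <- s | P i) F i) g = \sum_(i <- s | P i) tmul (F i) g.
Proof. by apply: (big_morph (tmul^~ g)) => // f h; apply: tmulDl. Qed.

Let tmulA : associative tmul.
Proof.
move=> f g h; rewrite [f](tensors_sum (@tboundP _ _ _ f)) !tmul_suml.
by apply: eq_bigr => i _; rewrite !tmul_tin tmul_tact.
Qed.

Definition tone : tensors := tin (1 : tpow M 0).

Let tmul1 : left_id tone tmul.
Proof. by move=> f; rewrite tmul_tin; apply: tensorsP => i; apply: lact1. Qed.

Lemma tshift_tin m i (x : tpow M i) : tshift m (tin x) = tin (tcons m x).
Proof.
apply: tensorsP => -[|j]; first by rewrite tin_neq.
rewrite -[LHS]/(tcons m (tin x j)); have [<-|ij] := eqVneq i j.
  by rewrite !tin_id.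
by rewrite !tin_neq ?tcons0.
Qed.

Let tact_tone i (x : tpow M i) : tact x tone = tin x.
Proof.
elim: i x => [|i IH] x.
  apply: tensorsP => j; rewrite -[LHS]/(lact (x : R) (tone j)).
  by case: j => [|j]; [rewrite !tin_id; apply: mulr1 | rewrite !tin_neq ?lact0r].
elim/tpow_ind: x => [m x|x y IHx IHy].
  by rewrite tact_tcons IH tshift_tin.
by rewrite tactDl IHx IHy; have := tin_linear 1 x y; rewrite !scale1r.
Qed.

Let t1mul : right_id tone tmul.
Proof.
move=> f; rewrite [f in tmul f](tensors_sum (@tboundP _ _ _ f)) tmul_suml.
rewrite [RHS](tensors_sum (@tboundP _ _ _ f)).
by apply: eq_bigr => i _; rewrite tmul_tin tact_tone.
Qed.

Definition tensor_algebra : pzAlgebra K :=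
  PzAlgebra tmulA tmul1 t1mul tmulDl tmulDr tscalAl tscalAr.

(* The inclusion of the n-th tensor power in the tensor algebra. *)
Definition tincl n (x : tpow M n) : tensor_algebra := tin x.

Lemma tincl_tcons m n (x : tpow M n) :
  tincl (tcons m x) = tincl (m : tpow M 1) * tincl x.
Proof. by apply: esym; apply: etrans (tmul_tin _ _) _; apply: tshift_tin. Qed.

Lemma tincl_tpure n (m : 'I_n -> M) :
  tincl (tpure m) = \prod_(i < n) tincl (m i : tpow M 1).
Proof.
elim: n m => [|n IH] m; first by rewrite big_ord0.
by rewrite big_ord_recl tpureS tincl_tcons IH.
Qed.

End TensorAlgebra.

(* The factor algebra of the tensor algebra by the relations
   m_1 (x) ... (x) m_n = phi (m_1 (x) ... (x) m_n).  It makes sense for any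
   function phi on the n-th tensor power. *)
Section FactorAlgebra.
Variables (K : fieldType) (R : pzAlgebra K) (M : bimodType R) (n : nat).
Variable phi : tpow M n -> regbim R.

Definition factor_algebra : pzAlgebra K :=
  quotalg (fun t : tensor_algebra M => exists m : 'I_n -> M,
    t = tincl (tpure m) - tincl (phi (tpure m) : tpow M 0)).

(* For 1 < n, each class modulo n is represented by a unique g < n. *)
Definition factor_grading (g : 'Z_n) (a : factor_algebra) : Prop :=
  exists x : tpow M g, a = quotalg_proj _ (tincl x).

End FactorAlgebra.

Arguments factor_algebra {K R M n} phi.
Arguments factor_grading {K R M n} phi g a.

Definition findim (K : fieldType) (V : lmodType K) : Prop :=
  exists d, inhabited (Vector.axiom d V).

Definition frobenius (K : fieldType) (A : pzAlgebra K) : Prop :=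
  findim A /\ exists f : dual A -> regbim A, left_iso f.

Definition symmetric_algebra (K : fieldType) (A : pzAlgebra K) : Prop :=
  findim A /\ exists f : dual A -> regbim A, bimod_iso f.

Definition is_subspace (K : fieldType) (V : lmodType K) (S : V -> Prop) : Prop :=
  S 0 /\ forall (k : K) x y, S x -> S y -> S (k *: x + y).

Section Graded.
Variables (K : fieldType) (A : pzAlgebra K) (G : zmodType).
Variable gr : G -> A -> Prop.

(* A is the internal direct sum of the subspaces gr g, and
   gr g * gr h is contained in gr (g + h). *)
Definition is_grading : Prop :=
  [/\ forall g, is_subspace (gr g),
      forall x, exists s : seq G, exists c : G -> A,
        (forall g, gr g (c g)) /\ x = \sum_(g <- s) c g,
      forall (s : seq G) (c : G -> A), uniq s -> (forall g, gr g (c g)) ->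
        \sum_(g <- s) c g = 0 -> forall g, g \in s -> c g = 0
    & forall g h x y, gr g x -> gr h y -> gr (g + h) (x * y)].

Definition dual_grading (g : G) (f : dual A) : Prop :=
  forall h, h != - g -> forall a, gr h a -> f a = 0.

(* The grading of the left A-module A(sigma). *)
Definition shift_grading (sigma g : G) (a : A) : Prop := gr (g + sigma) a.

Definition graded_frobenius (sigma : G) : Prop :=
  [/\ findim A, is_grading
    & exists2 f : dual A -> regbim A, left_iso f
      & forall g u, dual_grading g u <-> shift_grading sigma g (f u)].

End Graded.

(* Main.v *)
From HB Require Import structures.
Require Import Defs.
From mathcomp Require Import all_boot all_algebra.
From mathcomp Require Import boolp.

Set Implicit Arguments.
Unset Strict Implicit.
Unset Printing Implicit Defensive.

Import GRing.Theory.
Local Open Scope ring_scope.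

(** Write M = R^*, let T be the tensor algebra of M, and A the factor algebra.

   Associativity of phi. The maps x (x) y |-> phi(x) y and m (x) x |-> m phi(x)
   from M^(n+1) to M are isomorphisms of bimodules, so they differ by a bimodule
   automorphism of R^*, that is by a central unit c of R (twist_exists):
   m phi(x y) = c phi(m x) y. Shifting phi across n letters in
   phi(u) phi(u) = 1 gives c^n = 1 (twist_expn). Evaluating the functional
   m phi(x) at 1 yields a form on M^(n+1) in which a letter may be rotated from
   the last place to the first at the cost of one factor c, because the values
   of r m and m r at 1 agree for r in R and m in R^*; a full rotation gives
   c^(n+1) = 1 (twist1). Hence c = 1.

   Structure of A. The tensor algebra acts on R (+) M (+) ... (+) M^(n-1), and
   associativity says that the relations of A act by 0 (reduce_absorb). So acting
   on 1 gives normal forms of the elements of A, from which the Z_n-grading is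
   read off (factor_gradingP). Since phi is onto, A is strongly graded.

   Frobenius form. Let lam : A -> K be the degree 1 component, an element of R^*,
   evaluated at 1. It is symmetric, lam (a b) = lam (b a): on the generators R
   and M this is the agreement of r m and m r at 1 (factor_form_sym). It is
   nondegenerate: strong gradedness reduces this to degree 1, where it is the
   pairing of R^* with R (factor_form_nondeg). So a |-> lam (_ a) is an
   isomorphism of bimodules from A to A^*, and as lam lives in degree 1 it
   identifies A(1) with A^*.

   If R is Frobenius, then R^* = R theta, and strong gradedness makes theta a
   unit of A of degree 1; right multiplication by its powers identifies A(1)
   with A(i) for every i (factor_graded_frobenius_all).

   The bimodule R^* enters only through its functional of evaluation at 1
   (dualizing), so the arguments are carried out for a bimodule M with such a
   functional. *)

(** * Linear algebra *)

Section LinearFunction.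
Variables (K : fieldType) (V W : lmodType K) (f : V -> W).
Hypothesis fL : linear f.

Lemma linear_funD x y : f (x + y) = f x + f y.
Proof. by have := fL 1 x y; rewrite !scale1r. Qed.

Lemma linear_fun0 : f 0 = 0.
Proof. by have := fL (-1) 0 0; rewrite !scaleN1r !addNr. Qed.

Lemma linear_funZ k x : f (k *: x) = k *: f x.
Proof. by have := fL k x 0; rewrite linear_fun0 !addr0. Qed.

Lemma linear_funB x y : f (x - y) = f x - f y.
Proof. by rewrite -!scaleN1r linear_funD linear_funZ. Qed.

Lemma linear_fun_sum I (s : seq I) (P : pred I) (F : I -> V) :
  f (\sum_(i <- s | P i) F i) = \sum_(i <- s | P i) f (F i).
Proof. exact: (big_morph f linear_funD linear_fun0). Qed.

Lemma linear_comb I (s : seq I) (P : pred I) (c : I -> K) (v : I -> V) :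
  f (\sum_(i <- s | P i) c i *: v i) = \sum_(i <- s | P i) c i *: f (v i).
Proof. by rewrite linear_fun_sum; apply: eq_bigr => i _; apply: linear_funZ. Qed.

Lemma linear_eq0_inj : (forall x, f x = 0 -> x = 0) -> injective f.
Proof.
by move=> f0 x y fxy; apply/subr0_eq/f0; rewrite linear_funB fxy subrr.
Qed.

End LinearFunction.

Lemma mull_linear (K : fieldType) (A : pzAlgebra K) (t : A) :
  linear (fun u : A => t * u : A).
Proof. by move=> k u v; rewrite mulrDr pzscalerAr. Qed.

Lemma mulr_linear (K : fieldType) (A : pzAlgebra K) (t : A) :
  linear (fun u : A => u * t : A).
Proof. by move=> k u v; rewrite mulrDl pzscalerAl. Qed.

Section FiniteDimension.
Variable K : fieldType.
Implicit Types V W : lmodType K.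

Lemma inj_surj_bijective (T T' : Type) (f : T -> T') :
  injective f -> (forall y, exists x, f x = y) -> bijective f.
Proof.
move=> fI fS; exists (fun y => sval (cid (fS y))) => [x|y].
  by apply: fI; case: cid.
by case: cid.
Qed.

Definition dual_bases V d (e : 'I_d -> V) (es : 'I_d -> dual V) : Prop :=
  (forall x, x = \sum_i es i x *: e i) /\ forall i j, es i (e j) = (i == j)%:R.

Lemma axiom_dual_bases V d : inhabited (Vector.axiom d V) ->
  exists e es, @dual_bases V d e es.
Proof.
case=> -[f fL [g fK gK]].
have esL i : linear (fun x => f x 0 i : K^o).
  by move=> k x y; rewrite fL !mxE.
have gL : linear g.
  by move=> k x y; apply: (can_inj fK); rewrite fL !gK.
exists (fun i => g (delta_mx 0 i)), (fun i => mkdual (esL i)); split=> [x|i j].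
  rewrite -(linear_comb gL) -[LHS]fK; congr g.
  by rewrite {1}(row_sum_delta (f x)).
by rewrite /dual_fun /= gK mxE eqxx.
Qed.

Lemma dual_bases_axiom V d e es : @dual_bases V d e es ->
  inhabited (Vector.axiom d V).
Proof.
case=> eE esE; constructor; exists (fun x => \row_i es i x).
  by move=> k x y; apply/rowP => i; rewrite !mxE dual_funP.
exists (fun v : 'rV_d => \sum_i v 0 i *: e i) => [x|v].
  by rewrite [RHS]eE; apply: eq_bigr => i _; rewrite mxE.
apply/rowP => i; rewrite mxE (linear_comb (dual_funP (es i))).
rewrite (bigD1 i) //= esE eqxx big1 ?addr0 => [|j ji].
  by rewrite /GRing.scale /= mulr1.
by rewrite esE eq_sym (negPf ji) scaler0.
Qed.

Lemma dual_expansion V d e es : @dual_bases V d e es ->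
  forall u : dual V, u = \sum_i u (e i) *: es i.
Proof.
move=> [eE _] u; apply: dualP => x.
have xL : linear (fun u : dual V => u x : K^o) by [].
rewrite [RHS](linear_comb xL) {1}[x]eE (linear_comb (dual_funP u)).
by apply: eq_bigr => i _; rewrite /GRing.scale /= mulrC.
Qed.

Lemma axiom_dual V d :
  inhabited (Vector.axiom d V) -> inhabited (Vector.axiom d (dual V)).
Proof.
move=> /axiom_dual_bases[e [es eesP]].
have evL i : linear (fun u : dual V => u (e i) : K^o) by [].
apply: (@dual_bases_axiom _ d es (fun i => mkdual (evL i))).
split=> [u|i j]; first exact: dual_expansion eesP u.
by have [_ esE] := eesP; rewrite [LHS]esE eq_sym.
Qed.

(** In equal finite dimensions injectivity suffices, since a square matrix with
   independent rows is invertible. *)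
Lemma axiom_inj_bijective V W d (f : V -> W) :
  inhabited (Vector.axiom d V) -> inhabited (Vector.axiom d W) ->
  linear f -> injective f -> bijective f.
Proof.
move=> [[v vL [v' vK v'K]]] [[w wL [w' wK w'K]]] fL fI.
have v'L : linear v' by move=> k x y; apply: (can_inj vK); rewrite vL !v'K.
have FL : linear (fun x => w (f (v' x))) by move=> k x y; rewrite v'L fL wL.
pose F : {linear 'rV[K]_d -> 'rV[K]_d} :=
  HB.pack_for {linear 'rV[K]_d -> 'rV[K]_d} (fun x => w (f (v' x)))
    (GRing.isLinear.Build _ _ _ _ _ FL).
have FE x : x *m lin1_mx F = w (f (v' x)) by apply: mul_rV_lin1.
have Funit : lin1_mx F \in unitmx.
  rewrite -row_free_unit; apply/inj_row_free => x; rewrite FE => Fx0.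
  apply: (can_inj v'K); apply: fI; apply: (can_inj wK); rewrite Fx0.
  by rewrite -(FE 0) mul0mx.
apply: inj_surj_bijective => // y.
exists (v' (w y *m invmx (lin1_mx F))); apply: (can_inj wK).
by rewrite -FE mulmxKV.
Qed.

Lemma findim_dual_ext V : findim V ->
  forall x y : V, (forall u : dual V, u x = u y) -> x = y.
Proof.
move=> [d /axiom_dual_bases[e [es [eE _]]]] x y xy; rewrite [x]eE [y]eE.
by apply: eq_bigr => i _; rewrite xy.
Qed.

Lemma findim_reflexive V : findim V ->
  forall F : dual V -> K^o, linear F -> exists x, forall u : dual V, F u = u x.
Proof.
move=> [d /axiom_dual_bases[e [es eesP]]] F FL.
exists (\sum_i F (es i) *: e i) => u.
rewrite {1}(dual_expansion eesP u) (linear_comb FL) (linear_comb (dual_funP u)).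
by apply: eq_bigr => i _; rewrite /GRing.scale /= mulrC.
Qed.

Definition fin_spanned V :=
  exists s : seq V, forall x, spanned (fun y => y \in s) x.

Lemma spanned_trans V (G H : V -> Prop) x :
  (forall y, G y -> spanned H y) -> spanned G x -> spanned H x.
Proof.
move=> GH; elim=> {x} [x /GH//||x y _ Hx _ Hy|k x _ Hx].
- exact: spanned0.
- exact: spannedD.
- exact: spannedZ.
Qed.

Lemma spanned_linear V W (f : V -> W) (G : V -> Prop) (H : W -> Prop) x :
  linear f -> (forall y, G y -> H (f y)) -> spanned G x -> spanned H (f x).
Proof.
move=> fL GH; elim=> {x} [x /GH ?||x y _ Hx _ Hy|k x _ Hx].
- exact: spanned_gen.
- by rewrite (linear_fun0 fL); apply: spanned0.
- by rewrite (linear_funD fL); apply: spannedD.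
- by rewrite (linear_funZ fL); apply: spannedZ.
Qed.

Lemma findim_fin_spanned V : findim V -> fin_spanned V.
Proof.
move=> [d /axiom_dual_bases[e [es [eE _]]]]; exists (codom e) => x; rewrite [x]eE.
elim/big_ind: _ => [|y z Hy Hz|i _]; first exact: spanned0.
  exact: spannedD.
by apply: spannedZ; apply: spanned_gen; apply: codom_f.
Qed.

(** A spanning family of minimal cardinality is a basis: in a nontrivial
   relation some vector is a combination of the others, and removing it would
   leave a smaller spanning family. *)
Lemma fin_spanned_findim V : fin_spanned V -> findim V.
Proof.
move=> [s sP].
pose spans d (e : 'I_d -> V) := forall x, exists c : 'I_d -> K,
  x = \sum_i c i *: e i.
have exd : exists d, `[< exists e, @spans d e >].
  exists (size s); apply/asboolP; exists (fun i => s`_i) => x.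
  elim: (sP x) => {x} [x xs||x y _ [c ->] _ [c' ->]|k x _ [c ->]].
  - have xi : (index x s < size s)%N by rewrite index_mem.
    exists (fun i => (i == Ordinal xi)%:R).
    rewrite (bigD1 (Ordinal xi)) //= eqxx scale1r nth_index // big1 ?addr0 //.
    by move=> i /negPf ->; rewrite scale0r.
  - by exists (fun=> 0); rewrite big1 // => i _; rewrite scale0r.
  - exists (fun i => c i + c' i); rewrite -big_split.
    by apply: eq_bigr => i _; rewrite scalerDl.
  - exists (fun i => k * c i); rewrite scaler_sumr.
    by apply: eq_bigr => i _; rewrite scalerA.
case: (ex_minnP exd) => d /asboolP[e eP] dmin.
have indep (c : 'I_d -> K) : \sum_i c i *: e i = 0 -> forall i, c i = 0.
  move=> ce0 i; apply/eqP/negPn/negP => ci0.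
  case: d e eP dmin c ce0 i ci0 => [|d] e eP dmin c ce0 i ci0.
    by case: i ci0.
  suff /dmin : `[< exists e, @spans d e >] by rewrite ltnn.
  apply/asboolP; exists (fun j => e (lift i j)) => x; have [a ->] := eP x.
  exists (fun j => a (lift i j) - a i * (c i)^-1 * c (lift i j)).
  have eiE : e i = - \sum_j ((c i)^-1 * c (lift i j)) *: e (lift i j).
    apply/(can_inj (scalerK ci0)); rewrite scalerN scaler_sumr.
    apply/eqP; rewrite -addr_eq0 -[X in _ == X]ce0 (bigD1_ord i) //=.
    apply/eqP; congr (_ + _); apply: eq_bigr => j _.
    by rewrite scalerA mulrA mulfV ?mul1r.
  rewrite (bigD1_ord i) //= eiE scalerN scaler_sumr addrC -sumrB.
  by apply: eq_bigr => j _; rewrite scalerBl scalerA mulrA.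
pose f (v : 'rV[K]_d) := \sum_i v 0 i *: e i.
have fL : linear f.
  move=> k v w; rewrite /f scaler_sumr -big_split; apply: eq_bigr => i _.
  by rewrite !mxE scalerDl scalerA.
have [g fK gK] : bijective f.
  apply: inj_surj_bijective => [|x].
    apply: (linear_eq0_inj fL) => v /indep v0.
    by apply/rowP => i; rewrite v0 mxE.
  have [c ->] := eP x; exists (\row_i c i).
  by apply: eq_bigr => i _; rewrite mxE.
exists d; constructor; exists g; last by exists f.
by move=> k x y; apply: (can_inj fK); rewrite fL !gK.
Qed.

End FiniteDimension.

(** * Homogeneous elements of the tensor algebra *)

Section Homogeneous.
Variables (K : fieldType) (R : pzAlgebra K) (M : bimodType R).
Local Notation T := (tensor_algebra M).
Implicit Types (r s : R) (m : M) (t : T) (i j : nat).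

Definition tscal r : T := tincl (r : tpow M 0).
Definition tvec m : T := tincl (m : tpow M 1).
(** Membership in the degree i component, as a predicate on the algebra: unlike
   in the type tpow M i, the degree may be replaced by an equal number, and
   concatenation is the product of the algebra. *)
Definition thom i t : Prop := exists x : tpow M i, t = tincl x.
Definition tcoef i t : tpow M i := (t : tensors M) i.

Arguments tcoef : simpl never.

Lemma tincl_linear i : linear (@tincl K R M i : tpow M i -> T).
Proof. exact: tin_linear. Qed.

Lemma tinclD i (x y : tpow M i) : tincl (x + y) = tincl x + tincl y :> T.
Proof. exact: (linear_funD (@tincl_linear i)). Qed.

Lemma tincl0 i : tincl (0 : tpow M i) = 0 :> T.
Proof. exact: (linear_fun0 (@tincl_linear i)). Qed.

Lemma tinclK i (x : tpow M i) : tcoef i (tincl x) = x.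
Proof. exact: tin_id. Qed.

Lemma tincl_inj i : injective (@tincl K R M i).
Proof. exact: can_inj (@tinclK i). Qed.

Lemma tcoef_neq i j (x : tpow M i) : i != j -> tcoef j (tincl x) = 0.
Proof. exact: tin_neq. Qed.

Lemma tcoef_linear i : linear (tcoef i).
Proof. by []. Qed.

Lemma tcoef_sum i I (s : seq I) (P : pred I) (F : I -> T) :
  tcoef i (\sum_(j <- s | P j) F j) = \sum_(j <- s | P j) tcoef i (F j).
Proof. exact: tcomp_sum. Qed.

Lemma tensor_sum t : exists N, t = \sum_(i < N) tincl (tcoef i t).
Proof. by have [N tN] := tcomp_fin t; exists N; apply: tensors_sum. Qed.

Lemma tincl_cons m i (x : tpow M i) : tincl (tcons m x) = tvec m * tincl x.
Proof. exact: tincl_tcons. Qed.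

Lemma tscal_tincl r i (x : tpow M i) : tscal r * tincl x = tincl (lact r x).
Proof.
apply: etrans (tmul_tin _ _) _; apply: tensorsP => j.
rewrite -[LHS]/(lact r (tin x j)).
have [<-|ij] := eqVneq i j; first by rewrite !tin_id.
by rewrite !tin_neq // lact0r.
Qed.

Lemma tcoef_tscal i r t : tcoef i (tscal r * t) = lact r (tcoef i t).
Proof. by rewrite /tcoef [tscal r * t]tmul_tin. Qed.

Lemma tscal1 : tscal 1 = 1.
Proof. by []. Qed.

Lemma tscalM r s : tscal (r * s) = tscal r * tscal s.
Proof. by rewrite [RHS]tscal_tincl. Qed.

Lemma tscal_linear : linear tscal.
Proof. exact: (@tincl_linear 0). Qed.

Lemma tvec_linear : linear tvec.
Proof. exact: (@tincl_linear 1). Qed.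

Lemma tscal_inj : injective tscal.
Proof. exact: (@tincl_inj 0). Qed.

Lemma tscal_tvec r m : tscal r * tvec m = tvec (lact r m).
Proof. exact: tscal_tincl. Qed.

Lemma tvec_tscal m r : tvec m * tscal r = tvec (ract m r).
Proof. by rewrite -tincl_cons. Qed.

Lemma thom_ind i (P : T -> Prop) :
  (forall m t, thom i t -> P (tvec m * t)) ->
  (forall t u, P t -> P u -> P (t + u)) ->
  forall t, thom i.+1 t -> P t.
Proof.
move=> Pm PD t [x ->]; elim/tpow_ind: x => [m x|x y IHx IHy].
  by rewrite tincl_cons; apply: Pm; exists x.
by rewrite tinclD; apply: PD.
Qed.

Lemma thom_ind_gt0 i (P : T -> Prop) : (0 < i)%N ->
  (forall m t, thom i.-1 t -> P (tvec m * t)) ->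
  (forall t u, P t -> P u -> P (t + u)) ->
  forall t, thom i t -> P t.
Proof. by case: i => // i _; apply: thom_ind. Qed.

Lemma tensor_algebra_ind (P : T -> Prop) :
  (forall r, P (tscal r)) -> (forall m t, P t -> P (tvec m * t)) ->
  (forall t u, P t -> P u -> P (t + u)) -> forall t, P t.
Proof.
move=> Pr Pm PD t; have [N ->] := tensor_sum t.
elim/big_rec: _ => [|i u _ Pu].
  by rewrite -(linear_fun0 tscal_linear).
apply: (PD) => //; have: thom i (tincl (tcoef i t)) by exists (tcoef i t).
move: (tincl _) => {}t; elim: (i : nat) t => [|{}i IH] t.
  by move=> [r ->]; apply: Pr.
by elim/thom_ind=> {t} [m t /IH|t t']; [apply: Pm|apply: PD].
Qed.

Lemma thomD i t u : thom i t -> thom i u -> thom i (t + u).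
Proof. by move=> [x ->] [y ->]; exists (x + y); rewrite tinclD. Qed.

Lemma thomM i j t u : thom i t -> thom j u -> thom (i + j) (t * u).
Proof.
move=> + uj; elim: i t => [|i IH] t.
  by move=> [r ->]; have [y ->] := uj; exists (lact r y); apply: tscal_tincl.
elim/thom_ind=> {t} [m t /IH[x tx]|t t' IHt IHt'].
  by exists (tcons m x); rewrite tincl_cons -mulrA tx.
by rewrite mulrDl; apply: thomD.
Qed.

Lemma thom_tscalMl i r t : thom i t -> thom i (tscal r * t).
Proof. by move=> ti; apply: (@thomM 0) => //; exists r. Qed.

Lemma thom_tscalMr i t r : thom i t -> thom i (t * tscal r).
Proof. by move=> ti; rewrite -[i]addn0; apply: thomM => //; exists r. Qed.

Lemma thom_tvecMl i m t : thom i t -> thom i.+1 (tvec m * t).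
Proof. by move=> ti; apply: (@thomM 1) => //; exists m. Qed.

Lemma thom_tvecMr i t m : thom i t -> thom i.+1 (t * tvec m).
Proof. by move=> ti; rewrite -addn1; apply: thomM => //; exists m. Qed.

(** Elimination form of M^(i+j) = M^i (x)_R M^j. *)
Lemma thom_split i j (P : T -> Prop) :
  (forall t u, thom i t -> thom j u -> P (t * u)) ->
  (forall t u, P t -> P u -> P (t + u)) ->
  forall t, thom (i + j) t -> P t.
Proof.
elim: i P => [|i IH] P PM PD t.
  by move=> tj; rewrite -[t]mul1r; apply: PM => //; exists (1 : R).
elim/thom_ind=> {t} [m t|t u]; last exact: PD.
apply: (IH (fun t => P (tvec m * t))) => [u v ui vj|u v Pu Pv].
  by rewrite mulrA; apply: PM => //; apply: (@thomM 1) => //; exists m.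
by rewrite mulrDr; apply: PD.
Qed.

Lemma tincl_tscal i (x : tpow M i) r : tincl x * tscal r = tincl (ract x r).
Proof.
case: i x => [|i] x; first by rewrite -[_ * _]tscalM.
elim: i x => [|i IH] x; first exact: tvec_tscal.
elim/tpow_ind: x => [m x|x y IHx IHy].
  rewrite tincl_cons -mulrA IH -tincl_cons; congr tincl.
  exact: esym (ract_tens m x r).
by rewrite tinclD mulrDl IHx IHy ractDl tinclD.
Qed.

Lemma tpure_ind i (P : tpow M i -> Prop) : (0 < i)%N ->
  (forall m : 'I_i -> M, P (tpure m)) ->
  (forall x y, P x -> P y -> P (x + y)) -> forall x, P x.
Proof.
case: i P => // i P _; elim: i P => [|i IH] P Pm PD x.
  exact: (Pm (fun=> x)).
elim/tpow_ind: x => [m x|]; last exact: PD.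
elim/IH: x => [m'|x y Px Py].
  (* the family m, m' 0, m' 1, ... *)
  pose f (j : 'I_i.+2) := oapp m' m (unlift ord0 j).
  have -> : m' = (fun j : 'I_i.+1 => f (lift ord0 j)).
    by apply/funext => j; rewrite /f liftK.
  by have := Pm f; rewrite tpureS /f unlift_none.
by rewrite (linear_funD (@tcons_linearr _ _ _ m i.+1)); apply: PD.
Qed.

Lemma fin_spanned_tpow i : findim R -> findim M -> fin_spanned (tpow M i).
Proof.
move=> /findim_fin_spanned[sR sRP] /findim_fin_spanned[sM sMP].
elim: i => [|i [s sP]]; first by exists sR.
exists [seq tcons m x | m <- sM, x <- s] => x.
elim/tpow_ind: x => [m x|x y]; last exact: spannedD.
pose H (z : tpow M i.+1) := exists2 m', m' \in sM & z = tcons m' x.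
have Hm : spanned H (tcons m x).
  by apply: (spanned_linear (tcons_linearl x) _ (sMP m)) => m' ?; exists m'.
apply: spanned_trans Hm => _ [m' m'M ->].
have mL := @tcons_linearr K R M m' i.
by apply: (spanned_linear mL _ (sP x)) => y ys; apply: allpairs_f.
Qed.

End Homogeneous.

Arguments tscal {K R M} r.
Arguments tcoef : simpl never.

(** * Modules over the tensor algebra *)

Section Fold.
Variables (K : fieldType) (R : pzAlgebra K) (M : bimodType R) (N : lmodType K).
Variables (l : R -> N -> N) (op : M -> N -> N) (e : N).
Hypothesis lLl : forall x, linear (l^~ x : R -> N).
Hypothesis lLr : forall r, linear (l r).
Hypothesis l1 : forall x, l 1 x = x.
Hypothesis lA : forall r s x, l (r * s) x = l r (l s x).
Hypothesis opLl : forall x, linear (op^~ x).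
Hypothesis opLr : forall m, linear (op m).
Hypothesis op_ract : forall m r x, op (ract m r) x = op m (l r x).
Hypothesis op_lact : forall r m x, l r (op m x) = op (lact r m) x.
Local Notation T := (tensor_algebra M).

Let fold :=
  fix fold (i : nat) : tpow M i -> N :=
  match i return tpow M i -> N with
  | 0 => fun r => l r e
  | i'.+1 =>
    match i' return (tpow M i' -> N) -> tpow M i'.+1 -> N with
    | 0 => fun _ m => op m e
    | _.+1 => fun fold' x => tens_lift (fun m y => op m (fold' y)) x
    end (fold i')
  end.
Arguments fold : clear implicits.

Let foldP i : linear (fold i) /\
  forall r (x : tpow M i), fold i (lact r x) = l r (fold i x).
Proof.
elim: i => [|[|i] [IHl IHr]].
- by split=> [|r x]; [exact: lLl | exact: lA].
- by split=> [|r x]; [exact: opLl | exact/esym/op_lact].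
have fP : balanced (fun m (y : tpow M i.+1) => op m (fold i.+1 y)).
  split=> [y|m k y y'|m r y]; first exact: opLl.
    by rewrite IHl opLr.
  by rewrite IHr op_ract.
have foldL : linear (fold i.+2) by exact: tens_lift_linear fP.
split=> // r x; elim/(@tpow_ind K R M i.+1): x => [m y|x y IHx IHy].
  rewrite lact_tcons; apply: etrans (tens_lift_tens fP _ _) _.
  by rewrite -op_lact; congr (l r _); exact: esym (tens_lift_tens fP _ _).
by rewrite lactDr !(linear_funD foldL) IHx IHy (linear_funD (lLr r)).
Qed.

Let foldS i m (x : tpow M i) : fold i.+1 (tcons m x) = op m (fold i x).
Proof.
case: i x => [|i] x; first exact: op_ract.
apply: (@tens_lift_tens _ _ _ _ _ (fun m (y : tpow M i.+1) => op m (fold i.+1 y))).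
have [IHl IHr] := foldP i.+1.
split=> [y|m' k y y'|m' r y]; first exact: opLl.
  by rewrite IHl opLr.
by rewrite IHr op_ract.
Qed.

(** The universal property of the tensor algebra for left modules: left
   actions of R and M on N which agree on M (x)_R N make N a module over the
   tensor algebra, whence a module morphism sending 1 to any given element. *)
Lemma tensor_algebra_fold : exists F : T -> N, [/\ linear F, F 1 = e,
  forall r t, F (tscal r * t) = l r (F t)
  & forall m t, F (tvec m * t) = op m (F t)].
Proof.
have foldL i : linear (fold i) by have [] := foldP i.
have fold_l i r (x : tpow M i) : fold i (lact r x) = l r (fold i x).
  by have [] := foldP i.
pose F (t : T) : N := \sum_(i < tbound t) fold i (tcoef i t).
have FE n (t : T) : (forall i, (n <= i)%N -> tcoef i t = 0) ->
    F t = \sum_(i < n) fold i (tcoef i t).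
  have wid m p : (m <= p)%N -> (forall i, (m <= i)%N -> tcoef i t = 0) ->
      \sum_(i < m) fold i (tcoef i t) = \sum_(i < p) fold i (tcoef i t).
    move=> mp tm; rewrite (big_ord_widen p (fun i => fold i (tcoef i t)) mp).
    rewrite big_mkcond; apply: eq_bigr => i _.
    by case: ltnP => // /tm ->; rewrite (linear_fun0 (foldL i)).
  move=> tn; rewrite /F; have [le|/ltnW le] := leqP (tbound t) n.
    by apply: wid => // i; apply: tboundP.
  by rewrite -(wid _ _ le tn).
have bnd (t : T) i : (tbound t <= i)%N -> tcoef i t = 0 by exact: tboundP.
exists F; split.
- move=> k t u; pose n := maxn (tbound t) (tbound u).
  have tn i : (n <= i)%N -> tcoef i t = 0.
    by rewrite geq_max => /andP[/bnd].
  have un i : (n <= i)%N -> tcoef i u = 0.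
    by rewrite geq_max => /andP[_ /bnd].
  have tun i : (n <= i)%N -> tcoef i (k *: t + u) = 0.
    by move=> ni; rewrite tcoef_linear tn // un // scaler0 addr0.
  rewrite (FE _ _ tn) (FE _ _ un) (FE _ _ tun) scaler_sumr -big_split /=.
  by apply: eq_bigr => i _; rewrite tcoef_linear foldL.
- rewrite (FE 1%N); last by move=> i i0; rewrite [LHS]tin_neq // ltn_eqF.
  by rewrite big_ord1 [tcoef _ _]tin_id /= l1.
- move=> r t; rewrite (FE _ _ (bnd t)) (FE (tbound t)); last first.
    by move=> i /bnd ti; rewrite tcoef_tscal ti lact0r.
  rewrite (linear_fun_sum (lLr r)); apply: eq_bigr => i _.
  by rewrite tcoef_tscal fold_l.
move=> m t; have coef0 : tcoef 0 (tvec m * t) = 0.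
  by rewrite /tcoef [tvec m * t]tmul_tin.
have coefS i : tcoef i.+1 (tvec m * t) = tcons m (tcoef i t).
  by rewrite /tcoef [tvec m * t]tmul_tin.
rewrite (FE _ _ (bnd t)) (FE (tbound t).+1) => [|[|i] // /bnd ti]; last first.
  by rewrite coefS ti tcons0.
rewrite big_ord_recl coef0 (linear_fun0 (foldL _)) add0r.
rewrite (linear_fun_sum (opLr m)).
by apply: eq_bigr => i _; rewrite coefS foldS.
Qed.

End Fold.

(** * Normal forms in degrees less than n *)

Section Reduction.
Variables (K : fieldType) (R : pzAlgebra K) (M : bimodType R) (n : nat).
Variable phi : tpow M n -> regbim R.
Hypothesis n_gt1 : (1 < n)%N.
Hypothesis phiL : linear phi.
Hypothesis phi_lact : forall (r : R) x, phi (lact r x) = lact r (phi x).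
Hypothesis phi_ract : forall x (r : R), phi (ract x r) = ract (phi x) r.
Local Notation T := (tensor_algebra M).
Implicit Types (r s : R) (m : M) (t a b : T) (i j : nat).

Let n_gt0 : (0 < n)%N := ltnW n_gt1.

Definition contract t : R := phi (tcoef n t).

(** Meant for elements of degrees at most n: phi wraps degree n around to degree
   0, and the lower degrees are kept. *)
Definition wrap t : T :=
  tscal (contract t) + \sum_(i < n) tincl (tcoef i t).

Lemma contract_tincl (x : tpow M n) : contract (tincl x) = phi x.
Proof. by rewrite /contract tinclK. Qed.

Lemma contract_linear : linear contract.
Proof. by move=> k t u; rewrite /contract tcoef_linear phiL. Qed.

Lemma contract_tscall r t : contract (tscal r * t) = r * contract t.
Proof. by rewrite /contract tcoef_tscal phi_lact. Qed.

Lemma contract_tscalr t r : thom n t -> contract (t * tscal r) = contract t * r.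
Proof. by move=> [x ->]; rewrite /contract tincl_tscal !tinclK phi_ract. Qed.

Lemma wrap_linear : linear wrap.
Proof.
move=> k t u; rewrite /wrap contract_linear tscal_linear scalerDr addrACA.
congr (_ + _); rewrite scaler_sumr -big_split; apply: eq_bigr => i _.
by rewrite tcoef_linear tincl_linear.
Qed.

Lemma wrap_tscal r t : wrap (tscal r * t) = tscal r * wrap t.
Proof.
rewrite /wrap mulrDr contract_tscall tscalM mulr_sumr; congr (_ + _).
by apply: eq_bigr => i _; rewrite tcoef_tscal tscal_tincl.
Qed.

Lemma wrap_low i t : (i < n)%N -> thom i t -> wrap t = t.
Proof.
move=> ltin [x ->]; rewrite /wrap /contract tcoef_neq ?ltn_eqF //.
rewrite (linear_fun0 phiL) (linear_fun0 (@tscal_linear _ _ _)) add0r.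
rewrite (bigD1 (Ordinal ltin)) //= tinclK big1 ?addr0 // => j ji.
by rewrite tcoef_neq ?tincl0 // eq_sym.
Qed.

Lemma wrap_top t : thom n t -> wrap t = tscal (contract t).
Proof.
move=> [x ->]; rewrite /wrap big1 ?addr0 // => i _.
by rewrite tcoef_neq ?tincl0 // gtn_eqF.
Qed.

(** M acts on R (+) M (+) ... (+) M^(n-1) by concatenation followed by phi, and
   this action extends to the tensor algebra whether or not phi is associative.
   Acting on 1 rewrites a tensor to degrees less than n, by applying phi whenever
   n letters have accumulated, reading from the right. *)
Lemma reduce_exists : exists F : T -> T, [/\ linear F, F 1 = 1,
  forall r t, F (tscal r * t) = tscal r * F t
  & forall m t, F (tvec m * t) = wrap (tvec m * F t)].
Proof.
apply: (@tensor_algebra_fold K R M T (fun r t => tscal r * t)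
          (fun m t => wrap (tvec m * t)) 1).
- by move=> t k r s; rewrite tscal_linear mulr_linear.
- by move=> r; exact: mull_linear.
- by move=> t; rewrite tscal1 mul1r.
- by move=> r s t; rewrite tscalM mulrA.
- by move=> t k m m'; rewrite tvec_linear mulr_linear wrap_linear.
- by move=> m k t u; rewrite mull_linear wrap_linear.
- by move=> m r t; rewrite -tvec_tscal mulrA.
- by move=> r m t; rewrite -wrap_tscal mulrA tscal_tvec.
Qed.

Definition reduce : T -> T := sval (cid reduce_exists).

Lemma reduce_linear : linear reduce.
Proof. by rewrite /reduce; case: cid => F []. Qed.
Lemma reduce1 : reduce 1 = 1.
Proof. by rewrite /reduce; case: cid => F []. Qed.
Lemma reduce_tscal r t : reduce (tscal r * t) = tscal r * reduce t.
Proof. by rewrite /reduce; case: cid => F []. Qed.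
Lemma reduce_tvec m t : reduce (tvec m * t) = wrap (tvec m * reduce t).
Proof. by rewrite /reduce; case: cid => F []. Qed.

Lemma reduce_low i t : (i < n)%N -> thom i t -> reduce t = t.
Proof.
elim: i t => [|i IH] t ltin.
  by move=> [r ->]; rewrite -[tincl _]mulr1 reduce_tscal reduce1.
elim/thom_ind=> {t} [m t it|t u IHt IHu]; last first.
  by rewrite (linear_funD reduce_linear) IHt IHu.
rewrite reduce_tvec IH ?(ltnW ltin) //; apply: (wrap_low ltin).
by apply: (@thomM _ _ _ 1) => //; exists m.
Qed.

Lemma reduce_top t : thom n t -> reduce t = tscal (contract t).
Proof.
move=> tn; rewrite -(wrap_top tn).
have top_ind P := @thom_ind_gt0 K R M n P n_gt0.
elim/top_ind: tn => {t} [m t tn|t u IHt IHu].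
  by rewrite reduce_tvec (reduce_low _ tn) // ltn_predL ltnW.
by rewrite (linear_funD reduce_linear) IHt IHu (linear_funD wrap_linear).
Qed.

Lemma reduce_tvec_top m t : thom n t ->
  reduce (tvec m * t) = tvec (ract m (contract t)).
Proof.
move=> tn; rewrite reduce_tvec reduce_top // tvec_tscal.
by apply: wrap_low n_gt1 _; exists (ract m (contract t)).
Qed.

(** The kernel of the reduction is a left ideal, as it annihilates a vector of a
   module. *)
Lemma reduce_mull_eq0 a b : reduce b = 0 -> reduce (a * b) = 0.
Proof.
move=> b0; elim/tensor_algebra_ind: a => [r|m a a0|a a' IHa IHa'].
- by rewrite reduce_tscal b0 mulr0.
- by rewrite -mulrA reduce_tvec a0 mulr0 (linear_fun0 wrap_linear).
- by rewrite mulrDl (linear_funD reduce_linear) IHa IHa' addr0.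
Qed.

Lemma reduce_mull a b b' :
  reduce b = reduce b' -> reduce (a * b) = reduce (a * b').
Proof.
move=> bb'; apply/subr0_eq; rewrite -(linear_funB reduce_linear) -mulrBr.
by apply: reduce_mull_eq0; rewrite (linear_funB reduce_linear) bb' subrr.
Qed.

End Reduction.

(** * Associativity of phi *)

(** A characterization of the bimodule R^* by its functional e = evaluation at
   1: the pairing (m, r) |-> e (m r) is perfect, and e takes the same value on
   r m and m r. *)
Definition dualizing (K : fieldType) (R : pzAlgebra K) (M : bimodType R)
    (e : M -> K^o) : Prop :=
  [/\ linear e, forall (r : R) m, e (lact r m) = e (ract m r),
      forall m, (forall r : R, e (ract m r) = 0) -> m = 0,
      forall r : R, (forall m, e (ract m r) = 0) -> r = 0
    & forall F : M -> K^o, linear F -> exists c : R, forall m, F m = e (ract m c)].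

Lemma dual_dualizing (K : fieldType) (R : pzAlgebra K) : findim R ->
  dualizing (fun u : dual R => u 1).
Proof.
move=> R_findim; split=> // [r m|m m0|r r0|F FL].
- by rewrite [LHS]dual_lactE [RHS]dual_ractE mul1r mulr1.
- by apply: dualP => s; rewrite -[s]mulr1 -dual_ractE m0.
- apply: (findim_dual_ext R_findim) => m; rewrite -[r]mulr1 -dual_ractE r0.
  exact/esym/(linear_fun0 (dual_funP m)).
have [c cF] := findim_reflexive R_findim FL.
by exists c => m; rewrite cF [RHS]dual_ractE mulr1.
Qed.

Section Associativity.
Variables (K : fieldType) (R : pzAlgebra K) (M : bimodType R) (e : M -> K^o).
Hypothesis eP : dualizing e.
Variable n : nat.
Hypothesis n_gt1 : (1 < n)%N.
Variable phi : tpow M n -> regbim R.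
Hypothesis phiL : linear phi.
Hypothesis phi_lact : forall (r : R) x, phi (lact r x) = lact r (phi x).
Hypothesis phi_ract : forall x (r : R), phi (ract x r) = ract (phi x) r.
Hypothesis phi_bij : bijective phi.
Local Notation T := (tensor_algebra M).
Implicit Types (r s c : R) (m y : M) (t a b : T) (i j k : nat).

Local Notation contract := (contract phi).
Local Notation reduce := (reduce phiL phi_lact).
Let reduceL : linear reduce. Proof. exact: reduce_linear. Qed.
Let contractL : linear contract. Proof. exact: contract_linear. Qed.
Let reduce_tscal r t : reduce (tscal r * t) = tscal r * reduce t.
Proof. exact: reduce_tscal. Qed.
Let reduce_tvec m t : reduce (tvec m * t) = wrap phi (tvec m * reduce t).
Proof. exact: reduce_tvec. Qed.
Let reduce_top t : thom n t -> reduce t = tscal (contract t).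
Proof. exact: reduce_top. Qed.
Let reduce_tvec_top m t : thom n t ->
  reduce (tvec m * t) = tvec (ract m (contract t)).
Proof. exact: reduce_tvec_top. Qed.
Let contract_tscall r t : contract (tscal r * t) = r * contract t.
Proof. exact: contract_tscall. Qed.
Let contract_tscalr t r : thom n t -> contract (t * tscal r) = contract t * r.
Proof. exact: contract_tscalr. Qed.

Lemma contract_unit : exists2 u : T, thom n u & contract u = 1.
Proof.
case: phi_bij => g phiK gK; exists (tincl (g 1)); first by exists (g 1).
by rewrite contract_tincl gK.
Qed.

Lemma contract_inj t t' :
  thom n t -> thom n t' -> contract t = contract t' -> t = t'.
Proof.
by move=> [x ->] [x' ->]; rewrite !contract_tincl => /(bij_inj phi_bij) ->.
Qed.

(* On M^(n+1) this is m (x) x |-> m phi(x). *)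
Let beta t : M := tcoef 1 (reduce t).
Let betaL : linear beta. Proof. by move=> k t t'; rewrite /beta reduceL. Qed.

Let beta_tvec m t : thom n t -> beta (tvec m * t) = ract m (contract t).
Proof.
by move=> tn; rewrite /beta reduce_tvec_top //; exact: (@tinclK _ _ _ 1).
Qed.

Let beta_lact r t : beta (tscal r * t) = lact r (beta t).
Proof. by rewrite /beta reduce_tscal tcoef_tscal. Qed.

Let beta_ract t r : thom n.+1 t -> beta (t * tscal r) = ract (beta t) r.
Proof.
elim/thom_ind=> {t} [m t tn|t t' IHt IHt'].
  have tnr := thom_tscalMr r tn.
  by rewrite -mulrA !beta_tvec // contract_tscalr // ractA.
by rewrite mulrDl !(linear_funD betaL) IHt IHt' ractDl.
Qed.

Let reduce_beta t : thom n.+1 t -> reduce t = tvec (beta t).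
Proof.
elim/thom_ind=> {t} [m t tn|t t' IHt IHt'].
  by rewrite reduce_tvec_top // beta_tvec.
rewrite (linear_funD reduceL) IHt IHt' (linear_funD betaL).
by rewrite (linear_funD (@tvec_linear _ _ _)).
Qed.

Let e_lract r m : e (lact r m) = e (ract m r). Proof. by case: eP. Qed.

Lemma dualizing_ext m m' : (forall r, e (ract m r) = e (ract m' r)) -> m = m'.
Proof.
case: eP => eL _ e0 _ _ mm'; apply/subr0_eq/e0 => r.
by rewrite -scaleN1r ractDl ractZl scaleN1r (linear_funB eL) mm' subrr.
Qed.

Lemma dualizing_ext_r r r' :
  (forall m, e (ract m r) = e (ract m r')) -> r = r'.
Proof.
case: eP => eL _ _ e0 _ rr'; apply/subr0_eq/e0 => m.
by rewrite -scaleN1r ractDr ractZr scaleN1r (linear_funB eL) rr' subrr.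
Qed.

(** The maps x (x) y |-> phi(x) y and m (x) x |-> m phi(x) from M^(n+1) to M are
   bimodule isomorphisms, so they differ by a bimodule endomorphism of M, and
   those of R^* are the multiplications by central elements: dually, they are
   the bimodule endomorphisms of R. *)
Lemma twist_exists : exists c : R,
  [/\ forall r, r * c = c * r, forall m, lact c m = ract m c
    & forall t y, thom n t ->
        beta (t * tvec y) = lact (contract t * c) y].
Proof.
(* u is the inverse image of 1, and h y = beta (u (x) y) is the endomorphism,
   because x = phi(x) u for every x of degree n. *)
have [u un u1] := contract_unit.
have uC r : u * tscal r = tscal r * u.
  apply: contract_inj; [exact: thom_tscalMr|exact: thom_tscalMl|].
  by rewrite contract_tscall contract_tscalr // u1 mul1r mulr1.
have uy y : thom n.+1 (u * tvec y) by exact: thom_tvecMr.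
pose h y := beta (u * tvec y).
have hL : linear (fun y => e (h y) : K^o).
  by case: eP => eL _ _ _ _ k x y; rewrite /h tvec_linear mull_linear betaL eL.
have h_lact r y : h (lact r y) = lact r (h y).
  by rewrite /h -beta_lact mulrA -uC -mulrA tscal_tvec.
have h_ract y r : h (ract y r) = ract (h y) r.
  by rewrite /h -beta_ract // -mulrA tvec_tscal.
have [c hc] : exists c, forall y, e (h y) = e (ract y c).
  by case: eP => _ _ _ _; apply.
have hE y : h y = ract y c.
  by apply: dualizing_ext => s; rewrite -!e_lract -h_lact hc lractA.
have hE' y : h y = lact c y.
  by apply: dualizing_ext => s; rewrite -h_ract hc -e_lract lractA.
have cC r : r * c = c * r.
  by apply: dualizing_ext_r => y; rewrite !ractA -!hE h_ract.
exists c; split=> // [m|t y tn]; first by rewrite -hE hE'.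
have -> : t = tscal (contract t) * u.
  apply: contract_inj => //; first exact: thom_tscalMl.
  by rewrite contract_tscall u1 mulr1.
by rewrite -mulrA beta_lact contract_tscall u1 mulr1 lactA -hE'.
Qed.

Section Twist.
Variable c : R.
Hypothesis cC : forall r, r * c = c * r.
Hypothesis c_vec : forall m, lact c m = ract m c.
Hypothesis c_twist : forall t y, thom n t ->
  beta (t * tvec y) = lact (contract t * c) y.

Let cX_C k r : r * c ^+ k = c ^+ k * r.
Proof. exact: (commrX k (cC r)). Qed.

Let cX_vec k m : lact (c ^+ k) m = ract m (c ^+ k).
Proof.
elim: k m => [|k IH] m; first by rewrite expr0 lact1 ract1.
by rewrite {1}exprSr lactA c_vec IH exprS ractA.
Qed.

Lemma tscal_twistC k t : tscal (c ^+ k) * t = t * tscal (c ^+ k).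
Proof.
elim/tensor_algebra_ind: t => [r|m t tC|t t' IHt IHt'].
- by rewrite -!tscalM cX_C.
- by rewrite mulrA tscal_tvec cX_vec -tvec_tscal -mulrA tC mulrA.
- by rewrite mulrDr mulrDl IHt IHt'.
Qed.

(** Since m phi(x y) = c phi(m x) y, applying phi one letter further to the right
   costs one factor c. The reduction of t b reads from the right, so it differs
   from applying phi to t by one factor for each letter of b. *)
Lemma reduce_twist k t b : thom n t -> thom k b ->
  reduce (t * b) = tscal (c ^+ k * contract t) * reduce b.
Proof.
elim: k t b => [|k IH] t b tn.
  move=> [r ->]; rewrite -[tincl r]/(tscal r).
  rewrite reduce_top; last exact: thom_tscalMr.
  rewrite contract_tscalr // expr0 mul1r tscalM -[tscal r in RHS]mulr1.
  by rewrite reduce_tscal reduce1 mulr1.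
elim/thom_ind=> {b} [y b bk|b b' IHb IHb']; last first.
  by rewrite mulrDr !(linear_funD reduceL) IHb IHb' mulrDr.
have top_ind P := @thom_ind_gt0 K R M n P (ltnW n_gt1).
elim/top_ind: tn => {t} [m x xn|t t' IHt IHt']; last first.
  rewrite mulrDl (linear_funD contractL) mulrDr (linear_funD reduceL) IHt IHt'.
  by rewrite (linear_funD (@tscal_linear _ _ _)) mulrDl.
have xyn : thom n (x * tvec y).
  by have := thom_tvecMr y xn; rewrite (ltn_predK n_gt1).
have mxn : thom n (tvec m * x).
  by have := thom_tvecMl m xn; rewrite (ltn_predK n_gt1).
have myE : tvec m * tscal (contract (x * tvec y))
    = tscal (contract (tvec m * x) * c) * tvec y.
  rewrite tvec_tscal -reduce_tvec_top // mulrA.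
  by rewrite reduce_beta ?c_twist -?tscal_tvec //; exact: thom_tvecMr.
have -> : tvec m * x * (tvec y * b) = tvec m * ((x * tvec y) * b).
  by rewrite !mulrA.
rewrite reduce_tvec IH // tscalM !mulrA -tscal_twistC -(mulrA (tscal _) (tvec m)).
rewrite myE mulrA -tscalM -mulrA (wrap_tscal phi_lact) -reduce_tvec.
by rewrite cC exprSr !mulrA.
Qed.

(** Take u with phi(u) = 1. Reducing u (x) u applies phi to the second factor
   first and gives 1; applying phi to the first factor first gives 1 as well, and
   the two differ by the factor c^n. *)
Lemma twist_expn : c ^+ n = 1.
Proof.
have [u un u1] := contract_unit.
apply: (@tscal_inj _ _ M); rewrite tscal1.
have ru : reduce u = 1 by rewrite reduce_top // u1.
have := reduce_twist un un; rewrite ru u1 !mulr1 => <-.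
rewrite (@reduce_mull _ _ _ _ _ phiL phi_lact u u 1) ?reduce1 //.
by rewrite mulr1.
Qed.

(* On M^(n+1) this is m (x) x |-> m(phi(x)) for M = R^*. *)
Let tau t := e (beta t).

(* Rotating one letter y from the right end to the left: for z of degree n,
   tau (z y) = e (c phi(z) y) = e (c y phi(z)) = tau (c y z). *)
Let tau_twist i j a b : (i + j = n.+1)%N -> thom i a -> thom j b ->
  tau (a * b) = tau (tscal (c ^+ j) * b * a).
Proof.
have tauL : linear tau.
  by case: eP => eL _ _ _ _ k x y; rewrite /tau betaL eL.
elim: j i a b => [|j IH] i a b.
  rewrite addn0 => -> an [r ->]; rewrite -[tincl r]/(tscal r) expr0 mul1r.
  by rewrite /tau beta_ract // beta_lact e_lract.
move=> ijn ai; elim/thom_ind=> {b} [y b bj|b b' IHb IHb']; last first.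
  by rewrite mulrDr mulrDr mulrDl !(linear_funD tauL) IHb IHb'.
have ijn' : (i.+1 + j)%N = n.+1 by rewrite addSnnS.
rewrite mulrA (IH _ _ _ ijn' (thom_tvecMr y ai) bj) mulrA.
set z := tscal _ * b * a.
have zn : thom n z.
  have -> : n = (j + i)%N by apply: succn_inj; rewrite -ijn' addnC addnS.
  by apply: thomM => //; apply: thom_tscalMl.
have -> : tscal (c ^+ j.+1) * (tvec y * b) * a = tscal c * (tvec y * z).
  by rewrite /z exprS tscalM -!mulrA; congr (_ * _); rewrite !mulrA -tscal_twistC.
by rewrite /tau c_twist // beta_lact beta_tvec // lactA e_lract -lractA.
Qed.

(** Rotating all n + 1 letters of a word of degree n + 1 restores the word, so
   that c^(n+1) = 1. Rotation needs a functional such as e: for other bimodules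
   with M^n = R, the scalar c can be a nontrivial n-th root of unity. *)
Lemma twist1 : c = 1.
Proof.
have [u un u1] := contract_unit.
suff cn1 : c ^+ n.+1 = 1 by rewrite -cn1 exprS twist_expn mulr1.
apply: dualizing_ext_r => m; rewrite ract1 -e_lract.
have mun := thom_tvecMl m un.
have mE : beta (tvec m * u) = m by rewrite beta_tvec // u1 ract1.
have h1 : thom 0 (1 : T) by exists (1 : R).
have := tau_twist (add0n _) h1 mun.
by rewrite mul1r mulr1 /tau beta_lact mE => ->.
Qed.

End Twist.

(** Associativity of phi, in the form in which the factor algebra uses it. *)
Lemma reduce_absorb t b : thom n t ->
  reduce (t * b) = tscal (contract t) * reduce b.
Proof.
move=> tn; have [c [cC c_vec c_twist]] := twist_exists.
have [N ->] := tensor_sum b; rewrite mulr_sumr !(linear_fun_sum reduceL) mulr_sumr.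
apply: eq_bigr => i _.
have bi : thom i (tincl (tcoef i b)) by exists (tcoef i b).
rewrite (reduce_twist cC c_vec c_twist tn bi).
by rewrite (twist1 cC c_vec c_twist) expr1n mul1r.
Qed.

End Associativity.

(** * Graded Frobenius algebras from bilinear forms *)

Section GradedAlgebra.
Variables (K : fieldType) (A : pzAlgebra K) (G : zmodType) (gr : G -> A -> Prop).
Hypothesis grP : is_grading gr.
Implicit Types (g h : G) (a b x : A).

Lemma graded0 g : gr g 0. Proof. by case: grP => /(_ g)[]. Qed.
Lemma gradedD g a b : gr g a -> gr g b -> gr g (a + b).
Proof. by case: grP => /(_ g)[_ grL] _ _ _ ga /(grL 1 _ _ ga); rewrite scale1r. Qed.
Lemma gradedM g h a b : gr g a -> gr h b -> gr (g + h) (a * b).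
Proof. by case: grP => _ _ _; apply. Qed.

Lemma graded_decomposition x : exists s (c : G -> A),
  [/\ uniq s, forall g, gr g (c g) & x = \sum_(g <- s) c g].
Proof.
have [_ /(_ x)[s [c [cP ->]]] _ _] := grP.
exists (undup s), (fun g => c g *+ count_mem g s); split.
- exact: undup_uniq.
- move=> g; elim: (count_mem g s) => [|k IH]; first by rewrite mulr0n; apply: graded0.
  by rewrite mulrS; apply: gradedD.
by rewrite -(big_undup_iterop_count +%R).
Qed.

(** The form (b, a) |-> lam (b a) pairs degree g with degree sigma - g only, and
   its nondegeneracy is assumed for homogeneous elements. *)
Section FrobeniusForm.
Hypothesis A_findim : findim A.
Variables (lam : dual A) (sigma : G).
Hypothesis lam_gr : forall g a, g != sigma -> gr g a -> lam a = 0.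
Hypothesis lam_nondeg : forall g a, gr g a ->
  (forall b, gr (sigma - g) b -> lam (b * a) = 0) -> a = 0.

Let component_eq0 s (c : G -> A) k : uniq s -> (forall g, gr g (c g)) -> k \in s ->
  (forall b, gr (sigma - k) b -> lam (b * \sum_(g <- s) c g) = 0) -> c k = 0.
Proof.
move=> s_uniq cP ks lam0; apply: lam_nondeg (cP k) _ => b bP.
rewrite -[RHS](lam0 b bP) mulr_sumr (linear_fun_sum (dual_funP lam)).
rewrite (bigD1_seq k) //= big1 ?[RHS]addr0 // => g gk.
apply: lam_gr (gradedM bP (cP g)); apply: contra_neq gk => sgE.
by apply: (addrI (sigma - k)); rewrite sgE subrK.
Qed.

Let Lam a : dual A := lact a lam.

Let LamL : linear Lam.
Proof. by move=> k a b; rewrite /Lam lactDl lactZl. Qed.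

Let LamM (r : A) (x : regbim A) : Lam (lact r x) = lact r (Lam x).
Proof. exact: lactA. Qed.

Let Lam_inj : injective Lam.
Proof.
apply: (linear_eq0_inj LamL) => x Lx0.
have [s [c [s_uniq cP xE]]] := graded_decomposition x.
rewrite xE big_seq big1 // => g gs; apply: component_eq0 s_uniq cP gs _ => b _.
by rewrite -xE -dual_lactE -[lact x lam]/(Lam x) Lx0.
Qed.

Let Lam_bij : bijective Lam.
Proof.
have [d Ad] := A_findim.
exact: axiom_inj_bijective Ad (axiom_dual Ad) LamL Lam_inj.
Qed.

(** The isomorphism A -> A^* is a |-> lam (_ a); it lowers degrees by sigma
   since lam lives in degree sigma. *)
Lemma graded_frobenius_of_form : graded_frobenius gr sigma.
Proof.
have [f LamK fK] := Lam_bij; split=> //; exists f.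
  split; last by exists Lam.
  - by move=> k u v; apply: Lam_inj; rewrite LamL !fK.
  - by move=> r u; apply: Lam_inj; rewrite LamM !fK.
move=> g u; set x : A := f u; have uE : u = Lam x by rewrite fK.
split=> [u_gr|x_gr h hg b b_gr]; last first.
  rewrite uE dual_lactE; apply: lam_gr (gradedM b_gr x_gr).
  apply: contra_neq hg => /(congr1 (fun k => k - sigma - g)).
  by rewrite addrA addrK addrK subrr add0r.
have [s [c [s_uniq cP xE]]] := graded_decomposition x.
rewrite /shift_grading xE big_seq.
elim/big_rec: _ => [|k a ks a_gr]; first exact: graded0.
apply: gradedD => //; have [->//|kg] := eqVneq (g + sigma) k.
rewrite (component_eq0 s_uniq cP ks); first exact: graded0.
move=> b b_gr.
rewrite -xE -dual_lactE -[lact x lam]/(Lam x) -uE; apply: u_gr b_gr.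
apply: contra_neq kg => /(congr1 (fun h => g + h + k)).
by rewrite subrr add0r addrA subrK.
Qed.

Lemma symmetric_of_form : (forall a b, lam (a * b) = lam (b * a)) ->
  symmetric_algebra A.
Proof.
move=> lamC; have [f LamK fK] := Lam_bij; split=> //; exists f.
have Lam_ract a : Lam a = ract lam a.
  by apply: dualP => b; rewrite [LHS]dual_lactE [RHS]dual_ractE.
split.
  split; last by exists Lam.
  - by move=> k u v; apply: Lam_inj; rewrite LamL !fK.
  - by move=> r u; apply: Lam_inj; rewrite LamM !fK.
move=> u r; apply: Lam_inj; rewrite fK; apply: esym.
by apply: etrans (Lam_ract (f u * r)) _; rewrite ractA -Lam_ract fK.
Qed.

End FrobeniusForm.

(** Right multiplication by a homogeneous unit of degree k is an isomorphism
   A(sigma) -> A(sigma + k) of graded left modules. *)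
Lemma graded_frobenius_shift sigma k (w w' : A) :
  gr k w -> gr (- k) w' -> w * w' = 1 -> w' * w = 1 ->
  graded_frobenius gr sigma -> graded_frobenius gr (sigma + k).
Proof.
move=> wk w'k ww' w'w [A_findim _ [f [fL f_lact [f' fK f'K]] f_gr]].
split=> //; exists (fun u => f u * w : A).
  split=> [c u v|r u|].
  - by rewrite fL; exact: mulr_linear.
  - by rewrite f_lact; exact: esym (mulrA _ _ _).
  exists (fun x : A => f' (x * w')) => x.
    by rewrite -mulrA ww' mulr1 fK.
  by rewrite f'K -mulrA w'w mulr1.
move=> g u; rewrite f_gr /shift_grading addrA; split=> [fu|fuw].
  exact: gradedM.
by have := gradedM fuw w'k; rewrite addrK -mulrA ww' mulr1.
Qed.

End GradedAlgebra.

Lemma findim_left_inverse (K : fieldType) (A : pzAlgebra K) (w w' : A) :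
  findim A -> w' * w = 1 -> w * w' = 1.
Proof.
move=> [d Ad] w'w.
have wI : injective (fun x : A => x * w' : A).
  by move=> x y xy; rewrite -[x]mulr1 -[y]mulr1 -w'w !mulrA xy.
have [v vK Kv] := axiom_inj_bijective Ad Ad (mulr_linear w') wI.
have [z zw'] : exists z, z * w' = 1 by exists (v 1); exact: Kv.
by have <- : z = w by rewrite -[z]mulr1 -w'w mulrA zw' mul1r.
Qed.

(** * The grading of the factor algebra *)

Section FactorAlgebra.
Variables (K : fieldType) (R : pzAlgebra K) (M : bimodType R) (n : nat).
Hypothesis n_gt1 : (1 < n)%N.
Variable phi : tpow M n -> regbim R.
Hypothesis phiL : linear phi.
Hypothesis phi_lact : forall (r : R) x, phi (lact r x) = lact r (phi x).
Local Notation T := (tensor_algebra M).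
Local Notation A := (factor_algebra phi).
Local Notation gr := (factor_grading phi).
Local Notation contract := (contract phi).
Local Notation reduce := (reduce phiL phi_lact).
Implicit Types (r s : R) (m : M) (t u : T) (i j : nat) (g h : 'Z_n) (a b : A).
Hypothesis absorb : forall t u, thom n t ->
  reduce (t * u) = tscal (contract t) * reduce u.

Let n_gt0 : (0 < n)%N := ltnW n_gt1.
Let reduceL : linear reduce. Proof. exact: reduce_linear. Qed.

Definition fproj t : A := quotalg_proj _ t.

Lemma fproj_linear : linear fproj. Proof. exact: quotalg_proj_linear. Qed.
Lemma fprojD t u : fproj (t + u) = fproj t + fproj u.
Proof. exact: linear_funD fproj_linear t u. Qed.
Lemma fprojM t u : fproj (t * u) = fproj t * fproj u.
Proof. exact: quotalg_projM. Qed.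
Lemma fproj1 : fproj 1 = 1. Proof. exact: quotalg_proj1. Qed.
Lemma fproj_surj a : exists t, a = fproj t.
Proof. exact: quotalg_proj_surj. Qed.

Lemma fproj_contract t : thom n t -> fproj t = fproj (tscal (contract t)).
Proof.
move=> [x ->]; rewrite contract_tincl.
have ind := @tpure_ind K R M n.
elim/ind: x => // [m|x y IHx IHy]; last first.
  rewrite tinclD (linear_funD phiL) (linear_funD (@tscal_linear _ _ _)).
  by rewrite !fprojD IHx IHy.
apply/subr0_eq; rewrite -(linear_funB fproj_linear).
by apply/quotalg_proj_eq0/in_ideal_gen; exists m.
Qed.

(** The reduction factors through the factor algebra; since it fixes tensors of
   degree less than n, they inject into the factor algebra. *)
Lemma reduce_fproj t : fproj t = 0 -> reduce t = 0.
Proof.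
move=> /quotalg_proj_eq0 tI; rewrite -[t]mulr1; move: (1 : T) => u.
elim: tI u => {t} [_ [m ->]||t v _ IHt _ IHv|a t _ IHt|t a _ IHt] u.
- have mn : thom n (tincl (tpure m) : T) by exists (tpure m).
  rewrite mulrBl (linear_funB reduceL) absorb //.
  by rewrite contract_tincl reduce_tscal subrr.
- by rewrite mul0r (linear_fun0 reduceL).
- rewrite mulrDl (linear_funD reduceL).
  by rewrite IHt IHv addr0.
- by rewrite -mulrA reduce_mull_eq0.
by rewrite -mulrA IHt.
Qed.

Definition normal_form a : T := reduce (sval (cid (fproj_surj a))).

Lemma normal_form_fproj t : normal_form (fproj t) = reduce t.
Proof.
rewrite /normal_form; case: cid => u /= ut; apply/subr0_eq.
rewrite -(linear_funB reduceL); apply: reduce_fproj.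
by rewrite (linear_funB fproj_linear) ut subrr.
Qed.

Lemma normal_form_linear : linear normal_form.
Proof.
move=> k a b; have [t ->] := fproj_surj a; have [u ->] := fproj_surj b.
by rewrite -fproj_linear !normal_form_fproj reduceL.
Qed.

Lemma factor_grE g a : gr g a <-> exists2 t, thom g t & a = fproj t.
Proof.
by split=> [[x ->]|[_ [x ->] ->]]; [exists (tincl x) => //; exists x|exists x].
Qed.

Lemma Zn_ltn g : (g < n)%N.
Proof. by rewrite -[X in (_ < X)%N](Zp_cast n_gt1). Qed.

Lemma factor_gr_subspace g : is_subspace (gr g).
Proof.
split=> [|k _ _ [x ->] [y ->]].
  by exists 0; rewrite [tincl _]tincl0; exact/esym/(linear_fun0 fproj_linear).
by exists (k *: x + y); rewrite -[RHS]/(fproj _) tincl_linear fproj_linear.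
Qed.

Lemma factor_grD g a b : gr g a -> gr g b -> gr g (a + b).
Proof.
by have [_ grL] := factor_gr_subspace g => ga /(grL 1 _ _ ga); rewrite scale1r.
Qed.

(** Wrapping n letters at a time, a tensor of any degree i is equal in the factor
   algebra to one of degree i modulo n. *)
Lemma gr_fproj i t : thom i t -> gr i%:R (fproj t).
Proof.
elim/ltn_ind: i t => i IH t ti; have [ltin|leni] := ltnP i n.
  by apply/factor_grE; exists t; rewrite // val_Zp_nat // modn_small.
move: ti; rewrite -(subnKC leni) natrD pchar_Zp // add0r.
elim/thom_split=> {t} [t u tn ui|t u]; last by rewrite fprojD; apply: factor_grD.
rewrite fprojM fproj_contract // -fprojM; apply: IH; last exact: thom_tscalMl.
by rewrite ltn_subrL n_gt0 (leq_trans n_gt0).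
Qed.

Lemma factor_gradingP : is_grading gr.
Proof.
split.
- exact: factor_gr_subspace.
- move=> a; have [t ->] := fproj_surj a; have [N ->] := tensor_sum t.
  exists (index_enum 'Z_n).
  rewrite (linear_fun_sum fproj_linear).
  elim/big_rec: _ => [|i b _ [c [cP ->]]].
    by exists (fun=> 0); rewrite big1 //; split=> // g; case: (factor_gr_subspace g).
  have gi : gr i%:R (fproj (tincl (tcoef i t))).
    by apply: gr_fproj; exists (tcoef i t).
  exists (fun g => (if g == i%:R then fproj (tincl (tcoef i t)) else 0) + c g).
  split=> [g|].
    by apply: factor_grD => //; case: eqP => [->|_] //; case: (factor_gr_subspace g).
  by rewrite big_split -big_mkcond big_pred1_eq.
- move=> s c s_uniq cP c0 g gs.
  have [x xE] : exists x : forall g, tpow M g, forall g, c g = fproj (tincl (x g)).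
    by exists (fun g => sval (cid (cP g))) => h; case: cid.
  have nfE h : normal_form (fproj (tincl (x h))) = tincl (x h).
    have xh : thom h (tincl (x h)) by exists (x h).
    by rewrite normal_form_fproj (reduce_low phiL phi_lact (Zn_ltn h) xh).
  suff xg0 : x g = 0 by rewrite xE xg0 tincl0 (linear_fun0 fproj_linear).
  have := congr1 (fun a => tcoef g (normal_form a)) c0.
  rewrite (linear_fun0 normal_form_linear) (linear_fun_sum normal_form_linear) tcoef_sum.
  rewrite (bigD1_seq g) //= big1 => [|h hg].
    by rewrite addr0 xE nfE tinclK.
  by rewrite xE nfE; apply: tcoef_neq; rewrite (inj_eq val_inj).
move=> g h a b /factor_grE[t tg ->] /factor_grE[u uh ->].
by rewrite -fprojM -(natr_Zp g) -(natr_Zp h) -natrD; apply/gr_fproj/thomM.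
Qed.

Lemma factor_findim : findim R -> findim M -> findim A.
Proof.
move=> R_findim M_findim; apply: fin_spanned_findim.
have tspan i : exists s : seq A,
    forall t, thom i t -> spanned (fun y => y \in s) (fproj t).
  have [s sP] := fin_spanned_tpow i R_findim M_findim.
  exists [seq fproj (tincl x) | x <- s] => _ [x ->].
  have fL : linear (fun x : tpow M i => fproj (tincl x)).
    by move=> k y z; rewrite tincl_linear fproj_linear.
  by apply: (spanned_linear fL _ (sP x)) => y ys; apply: map_f.
have [S SP] := choice tspan.
exists (flatten [seq S i | i <- iota 0 n]) => a.
have [s [c [_ cP ->]]] := graded_decomposition factor_gradingP a.
elim/big_rec: _ => [|g b _]; first exact: spanned0.
apply: spannedD; have /factor_grE[t tg ->] := cP g.
apply: spanned_trans (SP _ _ tg) => y yS; apply: spanned_gen.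
by apply/flatten_mapP; exists (g : nat); rewrite // mem_iota Zn_ltn.
Qed.

End FactorAlgebra.

(** * The Frobenius form of the factor algebra *)

Section FrobeniusFactorAlgebra.
Variables (K : fieldType) (R : pzAlgebra K) (M : bimodType R) (e : M -> K^o).
Hypothesis R_findim : findim R.
Hypothesis M_findim : findim M.
Hypothesis eP : dualizing e.
Variable n : nat.
Hypothesis n_gt1 : (1 < n)%N.
Variable phi : tpow M n -> regbim R.
Hypothesis phiP : bimod_iso phi.
Local Notation T := (tensor_algebra M).
Local Notation A := (factor_algebra phi).
Local Notation gr := (factor_grading phi).
Local Notation fproj := (fproj phi).
Implicit Types (r s : R) (m : M) (t u v : T) (i j : nat) (g h : 'Z_n) (a b : A).

Let phiL : linear phi. Proof. by case: phiP => [[]]. Qed.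
Let phi_lact (r : R) x : phi (lact r x) = lact r (phi x).
Proof. by case: phiP => [[]]. Qed.
Let phi_ract x (r : R) : phi (ract x r) = ract (phi x) r.
Proof. by case: phiP. Qed.
Let phi_bij : bijective phi. Proof. by case: phiP => [[]]. Qed.

Local Notation reduce := (reduce phiL phi_lact).
Let absorb t u : thom n t ->
  reduce (t * u) = tscal (contract phi t) * reduce u.
Proof. exact: (reduce_absorb eP n_gt1 phiL phi_lact phi_ract phi_bij). Qed.

Let A_findim : findim A.
Proof. exact: (factor_findim n_gt1 absorb). Qed.
Let grP : is_grading gr.
Proof. exact: (factor_gradingP n_gt1 absorb). Qed.
Let gr_fproj i t : thom i t -> gr i%:R (fproj t).
Proof. exact: (gr_fproj n_gt1 phiL). Qed.
Let fprojM t u : fproj (t * u) = fproj t * fproj u.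
Proof. exact: fprojM. Qed.
Let fprojL : linear fproj. Proof. exact: fproj_linear. Qed.

Let nf := normal_form phiL phi_lact.

Let lam_linear : linear (fun a => e (tcoef 1 (nf a)) : K^o).
Proof.
have [eL _ _ _ _] := eP => k a b.
by rewrite /nf (normal_form_linear absorb) tcoef_linear eL.
Qed.

(** The component in degree 1, which is M, evaluated by e. *)
Definition factor_form : dual A := mkdual lam_linear.
Local Notation lam := factor_form.

Lemma factor_form_fproj t : lam (fproj t) = e (tcoef 1 (reduce t)).
Proof. by rewrite -(normal_form_fproj absorb). Qed.

Lemma factor_form_tvec m : lam (fproj (tvec m)) = e m.
Proof.
have m1 : thom 1 (tvec m) by exists m.
rewrite factor_form_fproj (reduce_low phiL phi_lact n_gt1 m1).
by rewrite [tcoef _ _](@tinclK _ _ _ 1).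
Qed.

Lemma factor_form_gr g a : g != 1 -> gr g a -> lam a = 0.
Proof.
have [eL _ _ _ _] := eP.
move=> g1 [x ->]; have xg : thom g (tincl x) by exists x.
rewrite factor_form_fproj (reduce_low phiL phi_lact (Zn_ltn n_gt1 g) xg).
by rewrite tcoef_neq ?(linear_fun0 eL).
Qed.

Lemma fproj_unit : exists2 u : T, thom n u & fproj u = 1.
Proof.
have [u un u1] := contract_unit phi_bij; exists u => //.
by rewrite (fproj_contract n_gt1 phiL un) u1 fproj1.
Qed.

(** The factor algebra is strongly graded: 1 is a sum of products of elements of
   degrees n - j and j. *)
Lemma annihilator_eq0 j a : (j <= n)%N ->
  (forall t, thom j t -> fproj t * a = 0) -> a = 0.
Proof.
move=> jn a0; have [u un u1] := fproj_unit; rewrite -[a]mul1r -u1.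
move: un; rewrite -[X in thom X _](subnK jn); elim/thom_split=> {u u1} [t u _ uj|t u t0 u0].
  by rewrite fprojM -mulrA a0 ?mulr0.
by rewrite (linear_funD fprojL) mulrDl t0 u0 addr0.
Qed.

(** If a of degree g is orthogonal to degree 1 - g, then R is orthogonal to b a
   for every b of degree 1 - g. As b a lies in degree 1, which is M, and the
   pairing of M with R is perfect, b a = 0; so degree 1 - g annihilates a. *)
Lemma factor_form_nondeg g a : gr g a ->
  (forall b, gr (1 - g) b -> lam (b * a) = 0) -> a = 0.
Proof.
have [eL eC e0 _ _] := eP.
move=> ga a0; pose k : 'Z_n := 1 - g; apply: (@annihilator_eq0 k) => [|t tj].
  exact/ltnW/Zn_ltn.
have tgr : gr (1 - g) (fproj t) by rewrite -(natr_Zp (1 - g)); apply: gr_fproj.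
have := gradedM grP tgr ga; rewrite subrK => -[m taE]; rewrite taE.
rewrite (e0 m) => [|r].
  by rewrite [tincl _]tincl0; exact: (linear_fun0 fprojL).
rewrite -eC -factor_form_tvec -tscal_tvec fprojM -[fproj (tvec m)]taE mulrA.
by apply: a0; rewrite -fprojM -(natr_Zp (1 - g)); apply/gr_fproj/thom_tscalMl.
Qed.

(** It suffices to let a run over the generators R and M. An element r of R only
   pairs with M and conversely, and e (r m) = e (m r). *)
Lemma factor_form_sym a b : lam (a * b) = lam (b * a).
Proof.
have [eL eC _ _ _] := eP.
have lamL : linear (lam : A -> K^o) by exact: dual_funP.
have gen g a' : gr g a' ->
    (forall b', gr (1 - g) b' -> lam (a' * b') = lam (b' * a')) ->
    forall b', lam (a' * b') = lam (b' * a').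
  move=> ga' a'C b'; have [s [c [_ cP ->]]] := graded_decomposition grP b'.
  rewrite mulr_sumr mulr_suml !(linear_fun_sum lamL); apply: eq_bigr => h _.
  have [hE|hg] := eqVneq (g + h) 1.
    by apply: a'C; rewrite -hE addrC addKr.
  rewrite (factor_form_gr hg (gradedM grP ga' (cP h))).
  by rewrite addrC in hg; rewrite (factor_form_gr hg (gradedM grP (cP h) ga')).
have rm r m : lam (fproj (tscal r) * fproj (tvec m))
    = lam (fproj (tvec m) * fproj (tscal r)).
  by rewrite -!fprojM tscal_tvec tvec_tscal !factor_form_tvec eC.
have rC r b' : lam (fproj (tscal r) * b') = lam (b' * fproj (tscal r)).
  apply: (gen 0) => [|{}b']; first by exists r.
  by rewrite subr0 => -[m ->]; exact: rm.
have mC m b' : lam (fproj (tvec m) * b') = lam (b' * fproj (tvec m)).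
  apply: (gen 1) => [|{}b']; first by exists m.
  by rewrite subrr => -[r ->]; exact/esym/rm.
have [t ->] := fproj_surj a.
elim/tensor_algebra_ind: t b => [r b|m t IH b|t u IHt IHu b].
- exact: rC.
- by rewrite fprojM -mulrA mC -mulrA IH mulrA.
- by rewrite (linear_funD fprojL) mulrDl mulrDr !(linear_funD lamL) IHt IHu.
Qed.

Lemma factor_graded_frobenius : graded_frobenius gr 1.
Proof.
exact: (graded_frobenius_of_form grP A_findim factor_form_gr factor_form_nondeg).
Qed.

Lemma factor_symmetric : symmetric_algebra A.
Proof.
exact: (symmetric_of_form grP A_findim factor_form_gr factor_form_nondeg
  factor_form_sym).
Qed.

(** If M = R theta, then theta is a homogeneous unit of degree 1, as 1 lies in
   the product of degree n - 1 with M = R theta. *)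
Lemma factor_graded_frobenius_all (theta : M) :
  (forall m, exists r : R, m = lact r theta) ->
  forall i, graded_frobenius gr i%:R.
Proof.
move=> thetaP i; pose w := fproj (tvec theta).
have w1 : gr 1 w by exists theta.
have [w' w'N w'w] : exists2 w', gr (-1) w' & w' * w = 1.
  have [u un <-] := fproj_unit; move: un; rewrite -[X in thom X _](ltn_predK n_gt1) -addn1.
  elim/thom_split=> {u} [t _ tn [m ->]|t u [a aN aE] [b bN bE]]; last first.
    exists (a + b); first exact: gradedD.
    by rewrite mulrDl aE bE (linear_funD fprojL).
  have [r ->] := thetaP m; exists (fproj (t * tscal r)).
    have -> : -1 = n.-1%:R :> 'Z_n.
      by apply/eqP; rewrite eq_sym -addr_eq0 natr1 (ltn_predK n_gt1) pchar_Zp.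
    exact/gr_fproj/thom_tscalMr.
  by rewrite -fprojM -mulrA tscal_tvec.
have ww' := findim_left_inverse A_findim w'w.
have powers k : [/\ gr k%:R (w ^+ k), gr (- k%:R) (w' ^+ k),
    w ^+ k * w' ^+ k = 1 & w' ^+ k * w ^+ k = 1].
  elim: k => [|k [IH1 IH2 IH3 IH4]].
    have g01 : gr 0 1 by exists (1 : R); exact/esym/fproj1.
    by rewrite !expr0 oppr0 mulr1.
  split.
  - by rewrite exprSr mulrSr; apply: gradedM.
  - by rewrite exprSr mulrSr opprD; apply: gradedM.
  - by rewrite exprSr exprS -mulrA (mulrA w) ww' mul1r.
  - by rewrite exprSr exprS -mulrA (mulrA w') w'w mul1r.
(* 1 + (i + n - 1) = i modulo n *)
have [wk w'k wkw' w'kw] := powers (i + n.-1)%N.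
have := graded_frobenius_shift grP wk w'k wkw' w'kw factor_graded_frobenius.
by rewrite nat1r -addnS (ltn_predK n_gt1) natrD pchar_Zp // addr0.
Qed.

End FrobeniusFactorAlgebra.

Theorem theoremC (K : fieldType) (R : pzAlgebra K) (hR : findim R)
    (n : nat) (hn : (2 <= n)%N)
    (phi : tpow (dual R) n -> regbim R) (hphi : bimod_iso phi) :
  (graded_frobenius (factor_grading phi) (1 : 'Z_n) /\
     symmetric_algebra (factor_algebra phi)) /\
  (frobenius R -> forall i : nat, (i < n)%N ->
     graded_frobenius (factor_grading phi) (i%:R : 'Z_n)).
Proof.
have dual_findim : findim (dual R).
  by have [d Rd] := hR; exists d; apply: axiom_dual.
have eP := dual_dualizing hR.
split; first split.
- exact: (@factor_graded_frobenius K R (dual R) _ hR dual_findim eP n hn phi hphi).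
- exact: (@factor_symmetric K R (dual R) _ hR dual_findim eP n hn phi hphi).
move=> [_ [f [fL f_lact [g fK gK]]]] i _.
apply: (@factor_graded_frobenius_all K R (dual R) _ hR dual_findim eP n hn phi hphi (g 1)).
(* theta corresponds to 1 under the isomorphism from R^* to R. *)
move=> m; exists (f m); apply: (can_inj fK); rewrite f_lact gK.
exact/esym/mulr1.
Qed.
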